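(* Let $\boldsymbol{\partial}$ be the set of all functions $\partial:[0,1]\to\mathbb{R}$ such that $|\partial(y)-\partial(z)|\leq |y-z|$ for all $y,z\in[0,1]$, and $\partial(1)\neq\partial(0)\pm 1$. Define $\partial\sim\partial'$ if there exists $a\in\mathbb{R}$ such that $\partial(y)=\partial'(y)+a$ for all $y\in[0,1]$. Then there is a bijection between $\boldsymbol{\partial}/{\sim}$ and the set of decorous submodules of representable projectives $P_x$, $x\in(0,1)$.
   Context: Let $\Bbbk$ be an algebraically closed field. $\Lambda_{\mathbb{R}}$ is the $\Bbbk$-linear category with objects the real numbers (plus a zero object) generated by morphisms $\alpha_{yx}:x\to y$ and $\alpha^*_{xy}:y\to x$ for $x<y$, with the convention $\alpha_{xx}=\alpha^*_{xx}=1_x$, subject to: (1) $\alpha_{zy}\alpha_{yx}=\alpha_{zx}$ and $\alpha^*_{xy}\alpha^*_{yz}=\alpha^*_{xz}$ for $x\le y\le z$; (2) $\alpha^*_{x+a-b,x+a}\alpha_{x+a,x}=\alpha_{x+a-b,x-b}\alpha^*_{x-b,x}$ for $x\in\mathbb{R}$ and $a,b$ positive reals. $\Lambda=\Lambda_{(0,1)}$ is the quotient category of $\Lambda_{\mathbb{R}}$ obtained by setting every object $x\notin(0,1)$ isomorphic to the zero object. A morphism of $\Lambda$ is path like if it is a nonzero composition of $\alpha$'s and $\alpha^*$'s; the length of $\alpha_{yx}$ and of $\alpha^*_{xy}$ is $|x-y|$, and the length of a composition is the sum of the lengths. A $\Lambda$-module is a $\Bbbk$-linear functor $\Lambda\to\Bbbk\text{-}\mathrm{Vec}$,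 and $P_x=\operatorname{Hom}_\Lambda(x,-)$ is the representable projective at $x\in(0,1)$. For a submodule $M\subseteq P_x$, define $\partial_\uparrow:[0,1]\to\mathbb{R}$ by $\partial_\uparrow(0)=x$, $\partial_\uparrow(1)=1-x$, and, for $y\in(0,1)$, $\partial_\uparrow(y)=\inf\{\mathrm{length}(f): f\in M(y)\text{ path like}\}$ if $M(y)\ne0$ and $\partial_\uparrow(y)=\sup\{\mathrm{length}(f): f\in\operatorname{Hom}_\Lambda(x,y)\text{ path like}\}$ if $M(y)=0$. The submodule $M$ is decorous if, for each $y\in(0,1)$ with $M(y)\neq0$, there exists a path like $f\in M(y)$ of length $\partial_\uparrow(y)$. *)

(* Defs.v *)
From HB Require Import structures.
From mathcomp Require Import all_boot all_order all_algebra.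
From mathcomp Require Import boolp classical_sets functions reals.

Set Implicit Arguments.
Unset Strict Implicit.
Unset Printing Implicit Defensive.

Import Order.TTheory GRing.Theory Num.Theory.

Local Open Scope classical_set_scope.
Local Open Scope quotient_scope.
Local Open Scope ring_scope.

(* A vector space whose axioms hold only up to the equivalence [pm_eqv]; the
   quotient by that equivalence is an honest [lmodType]. *)
Record premodule (k : fieldType) := Premodule {
  pm_car :> Type;
  pm_zero : pm_car;
  pm_add : pm_car -> pm_car -> pm_car;
  pm_scale : k -> pm_car -> pm_car;
  pm_eqv : pm_car -> pm_car -> Prop;
  pm_refl : forall u, pm_eqv u u;
  pm_sym : forall u v, pm_eqv u v -> pm_eqv v u;
  pm_trans : forall u v w, pm_eqv u v -> pm_eqv v w -> pm_eqv u w;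
  pm_addW : forall u u' v v', pm_eqv u u' -> pm_eqv v v' ->
    pm_eqv (pm_add u v) (pm_add u' v');
  pm_scaleW : forall a u u', pm_eqv u u' -> pm_eqv (pm_scale a u) (pm_scale a u');
  pm_addA : forall u v w,
    pm_eqv (pm_add u (pm_add v w)) (pm_add (pm_add u v) w);
  pm_addC : forall u v, pm_eqv (pm_add u v) (pm_add v u);
  pm_add0 : forall u, pm_eqv (pm_add pm_zero u) u;
  pm_addN : forall u, pm_eqv (pm_add (pm_scale (-1) u) u) pm_zero;
  pm_scaleA : forall a b u,
    pm_eqv (pm_scale a (pm_scale b u)) (pm_scale (a * b) u);
  pm_scale1 : forall u, pm_eqv (pm_scale 1 u) u;
  pm_scaleDr : forall a u v,
    pm_eqv (pm_scale a (pm_add u v)) (pm_add (pm_scale a u) (pm_scale a v));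
  pm_scaleDl : forall a b u,
    pm_eqv (pm_scale (a + b) u) (pm_add (pm_scale a u) (pm_scale b u)) }.

Section PremoduleQuotient.
Variables (k : fieldType) (A : premodule k).

Definition pm_rel : rel {classic A} := fun u v => `[< @pm_eqv k A u v >].

Lemma pm_rel_refl : reflexive pm_rel.
Proof. by move=> u; apply/asboolP/pm_refl. Qed.

Lemma pm_rel_sym : symmetric pm_rel.
Proof. by move=> u v; apply/asboolP/asboolP => /pm_sym. Qed.

Lemma pm_rel_trans : transitive pm_rel.
Proof.
by move=> v u w /asboolP uv /asboolP vw; apply/asboolP/(pm_trans uv vw).
Qed.

Definition pm_equiv := EquivRel pm_rel pm_rel_refl pm_rel_sym pm_rel_trans.

Definition pm_quot : Type := {eq_quot pm_equiv}.

HB.instance Definition _ := Choice.on pm_quot.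

Definition pm_cl (u : A) : pm_quot := \pi_({eq_quot pm_equiv}) u.

Definition pm_repr (q : pm_quot) : A := repr (q : {eq_quot pm_equiv}).

Lemma pm_clP (u v : A) : pm_cl u = pm_cl v <-> pm_eqv u v.
Proof.
by split=> [/eqmodP/asboolP//|uv]; apply/eqmodP/asboolP.
Qed.

Lemma pm_reprK q : pm_cl (pm_repr q) = q.
Proof. exact: reprK. Qed.

Lemma pm_repr_cl u : pm_eqv (pm_repr (pm_cl u)) u.
Proof. by apply/pm_clP; rewrite pm_reprK. Qed.

Definition pmq_add (p q : pm_quot) := pm_cl (pm_add (pm_repr p) (pm_repr q)).

Definition pmq_scale (a : k) (p : pm_quot) := pm_cl (pm_scale a (pm_repr p)).

Lemma pm_clD u v : pmq_add (pm_cl u) (pm_cl v) = pm_cl (pm_add u v).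
Proof. by apply/pm_clP; apply: pm_addW; apply: pm_repr_cl. Qed.

Lemma pm_clZ a u : pmq_scale a (pm_cl u) = pm_cl (pm_scale a u).
Proof. by apply/pm_clP; apply/pm_scaleW/pm_repr_cl. Qed.

Lemma pm_quotW (P : pm_quot -> Prop) : (forall u, P (pm_cl u)) -> forall q, P q.
Proof. by move=> H q; rewrite -(pm_reprK q). Qed.

Fact pmq_addA : associative pmq_add.
Proof.
elim/pm_quotW=> u; elim/pm_quotW=> v; elim/pm_quotW=> w.
by rewrite !pm_clD; apply/pm_clP/pm_addA.
Qed.

Fact pmq_addC : commutative pmq_add.
Proof.
by elim/pm_quotW=> u; elim/pm_quotW=> v; rewrite !pm_clD; apply/pm_clP/pm_addC.
Qed.

Fact pmq_add0 : left_id (pm_cl (pm_zero A)) pmq_add.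
Proof. by elim/pm_quotW=> u; rewrite !pm_clD; apply/pm_clP/pm_add0. Qed.

Fact pmq_addN : left_inverse (pm_cl (pm_zero A)) (pmq_scale (-1)) pmq_add.
Proof. by elim/pm_quotW=> u; rewrite pm_clZ pm_clD; apply/pm_clP/pm_addN. Qed.

HB.instance Definition _ :=
  GRing.isZmodule.Build pm_quot pmq_addA pmq_addC pmq_add0 pmq_addN.

Fact pmq_scaleA a b q : pmq_scale a (pmq_scale b q) = pmq_scale (a * b) q.
Proof. by elim/pm_quotW: q => u; rewrite !pm_clZ; apply/pm_clP/pm_scaleA. Qed.

Fact pmq_scale1 : left_id 1 pmq_scale.
Proof. by elim/pm_quotW=> u; rewrite !pm_clZ; apply/pm_clP/pm_scale1. Qed.

Fact pmq_scaleDr : right_distributive pmq_scale +%R.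
Proof.
move=> a; elim/pm_quotW=> u; elim/pm_quotW=> v.
rewrite -[pm_cl u + pm_cl v]/(pmq_add _ _) -[RHS]/(pmq_add _ _).
by rewrite !(pm_clZ, pm_clD); apply/pm_clP/pm_scaleDr.
Qed.

Fact pmq_scaleDl q : {morph pmq_scale^~ q : a b / a + b}.
Proof.
elim/pm_quotW: q => u a b; rewrite -[RHS]/(pmq_add _ _).
by rewrite !(pm_clZ, pm_clD); apply/pm_clP/pm_scaleDl.
Qed.

HB.instance Definition _ := GRing.Zmodule_isLmodule.Build k pm_quot
  pmq_scaleA pmq_scale1 pmq_scaleDr pmq_scaleDl.

Lemma pm_cl_lin a (u v : A) :
  pm_cl (pm_add (pm_scale a u) v) = a *: pm_cl u + pm_cl v.
Proof. by rewrite -pm_clD -pm_clZ. Qed.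

End PremoduleQuotient.

Arguments pm_cl {k A} u.
Arguments pm_repr {k A} q.

Record lincat (k : fieldType) := Lincat {
  ob :> Type;
  hom : ob -> ob -> lmodType k;
  idm : forall x, hom x x;
  cmp : forall x y z, hom y z -> hom x y -> hom x z;
  cmp1m : forall x y (f : hom x y), cmp (idm y) f = f;
  cmpm1 : forall x y (f : hom x y), cmp f (idm x) = f;
  cmpA : forall w x y z (h : hom y z) (g : hom x y) (f : hom w x),
    cmp h (cmp g f) = cmp (cmp h g) f;
  cmpPl : forall x y z a (g g' : hom y z) (f : hom x y),
    cmp (a *: g + g') f = a *: cmp g f + cmp g' f;
  cmpPr : forall x y z a (g : hom y z) (f f' : hom x y),
    cmp g (a *: f + f') = a *: cmp g f + cmp g f' }.

Arguments idm {k l} x.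
Arguments cmp {k l x y z} g f : rename.

(* A C-module is a k-linear functor from C to k-vector spaces. *)
Record catmodule (k : fieldType) (C : lincat k) := Catmodule {
  mod_ob :> C -> lmodType k;
  mod_map : forall x y, hom x y -> {linear mod_ob x -> mod_ob y};
  mod_map1 : forall x (v : mod_ob x), mod_map (idm x) v = v;
  mod_mapM : forall x y z (g : hom y z) (f : hom x y) (v : mod_ob x),
    mod_map (cmp g f) v = mod_map g (mod_map f v);
  mod_mapP : forall x y a (f g : hom x y) (v : mod_ob x),
    mod_map (a *: f + g) v = a *: mod_map f v + mod_map g v }.

Arguments mod_map {k C} M {x y} f : rename.

Record submodule (k : fieldType) (C : lincat k) (M : catmodule C) := Submodule {
  sub_ob :> forall y : C, set (M y);
  sub0 : forall y, @sub_ob y 0;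
  subP : forall y a u v, @sub_ob y u -> @sub_ob y v -> @sub_ob y (a *: u + v);
  sub_map : forall y z (f : hom y z) u, @sub_ob y u -> @sub_ob z (mod_map M f u) }.

Arguments sub_ob {k C M} s y _.

Section Representable.
Variables (k : fieldType) (C : lincat k) (x : C).

Definition rep_fun y z (f : hom y z) : hom x y -> hom x z := cmp f.

Fact rep_fun_linear y z (f : hom y z) : linear (rep_fun f).
Proof. by move=> a u v; apply: cmpPr. Qed.

HB.instance Definition _ y z (f : hom y z) :=
  GRing.isLinear.Build k (hom x y) (hom x z) *:%R (rep_fun f)
    (rep_fun_linear f).

Definition representable : catmodule C :=
  @Catmodule k C (hom x) (fun y z f => rep_fun f : {linear _ -> _})
    (fun y f => cmp1m f)
    (fun y z w g f v => esym (cmpA g f v))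
    (fun y z a f g v => cmpPl a f g v).

End Representable.

Section Presentation.
Variables (k : fieldType) (V : Type) (Q : V -> V -> Type).

Inductive term : V -> V -> Type :=
| tgen x y : Q x y -> term x y
| tid x : term x x
| tcmp x y z : term y z -> term x y -> term x z
| tzero x y : term x y
| tadd x y : term x y -> term x y -> term x y
| tscale x y : k -> term x y -> term x y.

Variable r : forall x y, term x y -> term x y -> Prop.

Inductive cong : forall x y, term x y -> term x y -> Prop :=
| cong_rel x y (s t : term x y) : r s t -> cong s t
| cong_refl x y (s : term x y) : cong s s
| cong_sym x y (s t : term x y) : cong s t -> cong t s
| cong_trans x y (s t u : term x y) : cong s t -> cong t u -> cong s u
| cong_cmp x y z (t t' : term y z) (s s' : term x y) :
    cong t t' -> cong s s' -> cong (tcmp t s) (tcmp t' s')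
| cong_add x y (s s' t t' : term x y) :
    cong s s' -> cong t t' -> cong (tadd s t) (tadd s' t')
| cong_scale x y a (s s' : term x y) :
    cong s s' -> cong (tscale a s) (tscale a s')
| cong_addA x y (s t u : term x y) :
    cong (tadd s (tadd t u)) (tadd (tadd s t) u)
| cong_addC x y (s t : term x y) : cong (tadd s t) (tadd t s)
| cong_add0 x y (s : term x y) : cong (tadd (tzero x y) s) s
| cong_addN x y (s : term x y) : cong (tadd (tscale (-1) s) s) (tzero x y)
| cong_scaleA x y a b (s : term x y) :
    cong (tscale a (tscale b s)) (tscale (a * b) s)
| cong_scale1 x y (s : term x y) : cong (tscale 1 s) s
| cong_scaleDr x y a (s t : term x y) :
    cong (tscale a (tadd s t)) (tadd (tscale a s) (tscale a t))
| cong_scaleDl x y a b (s : term x y) :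
    cong (tscale (a + b) s) (tadd (tscale a s) (tscale b s))
| cong_cmp1m x y (s : term x y) : cong (tcmp (tid y) s) s
| cong_cmpm1 x y (s : term x y) : cong (tcmp s (tid x)) s
| cong_cmpA w x y z (u : term y z) (t : term x y) (s : term w x) :
    cong (tcmp u (tcmp t s)) (tcmp (tcmp u t) s)
| cong_cmpPl x y z a (t t' : term y z) (s : term x y) :
    cong (tcmp (tadd (tscale a t) t') s) (tadd (tscale a (tcmp t s)) (tcmp t' s))
| cong_cmpPr x y z a (t : term y z) (s s' : term x y) :
    cong (tcmp t (tadd (tscale a s) s'))
         (tadd (tscale a (tcmp t s)) (tcmp t s')).

Definition pres_hom x y : premodule k :=
  @Premodule k (term x y) (tzero x y) (@tadd x y) (@tscale x y) (@cong x y)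
    (@cong_refl x y) (@cong_sym x y) (@cong_trans x y)
    (@cong_add x y) (@cong_scale x y)
    (@cong_addA x y) (@cong_addC x y) (@cong_add0 x y) (@cong_addN x y)
    (@cong_scaleA x y) (@cong_scale1 x y)
    (@cong_scaleDr x y) (@cong_scaleDl x y).

Definition pres_cl x y (t : term x y) : pm_quot (pres_hom x y) :=
  pm_cl (t : pres_hom x y).

Definition pres_cmp x y z (g : pm_quot (pres_hom y z))
    (f : pm_quot (pres_hom x y)) : pm_quot (pres_hom x z) :=
  pres_cl (tcmp (pm_repr g) (pm_repr f)).

Lemma pres_clE x y (s t : term x y) : pres_cl s = pres_cl t <-> cong s t.
Proof. exact: (@pm_clP k (pres_hom x y)). Qed.

Lemma pres_clM x y z (t : term y z) (s : term x y) :
  pres_cmp (pres_cl t) (pres_cl s) = pres_cl (tcmp t s).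
Proof.
apply/pres_clE; exact: cong_cmp (@pm_repr_cl k (pres_hom y z) t)
  (@pm_repr_cl k (pres_hom x y) s).
Qed.

Lemma pres_clP x y a (s t : term x y) :
  a *: pres_cl s + pres_cl t = pres_cl (tadd (tscale a s) t).
Proof. exact/esym/(@pm_cl_lin k (pres_hom x y)). Qed.

Lemma pres_quotW x y (P : pm_quot (pres_hom x y) -> Prop) :
  (forall t, P (pres_cl t)) -> forall q, P q.
Proof. exact: (@pm_quotW k (pres_hom x y)). Qed.

Fact pres_cmp1m x y (f : pm_quot (pres_hom x y)) :
  pres_cmp (pres_cl (tid y)) f = f.
Proof.
by elim/pres_quotW: f => s; rewrite pres_clM; apply/pres_clE/cong_cmp1m.
Qed.

Fact pres_cmpm1 x y (f : pm_quot (pres_hom x y)) :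
  pres_cmp f (pres_cl (tid x)) = f.
Proof.
by elim/pres_quotW: f => s; rewrite pres_clM; apply/pres_clE/cong_cmpm1.
Qed.

Fact pres_cmpA w x y z (h : pm_quot (pres_hom y z))
    (g : pm_quot (pres_hom x y)) (f : pm_quot (pres_hom w x)) :
  pres_cmp h (pres_cmp g f) = pres_cmp (pres_cmp h g) f.
Proof.
elim/pres_quotW: h => u; elim/pres_quotW: g => t; elim/pres_quotW: f => s.
by rewrite !pres_clM; apply/pres_clE/cong_cmpA.
Qed.

Fact pres_cmpPl x y z a (g g' : pm_quot (pres_hom y z))
    (f : pm_quot (pres_hom x y)) :
  pres_cmp (a *: g + g') f = a *: pres_cmp g f + pres_cmp g' f.
Proof.
elim/pres_quotW: g => t; elim/pres_quotW: g' => t'; elim/pres_quotW: f => s.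
by rewrite pres_clP !pres_clM pres_clP; apply/pres_clE/cong_cmpPl.
Qed.

Fact pres_cmpPr x y z a (g : pm_quot (pres_hom y z))
    (f f' : pm_quot (pres_hom x y)) :
  pres_cmp g (a *: f + f') = a *: pres_cmp g f + pres_cmp g f'.
Proof.
elim/pres_quotW: g => t; elim/pres_quotW: f => s; elim/pres_quotW: f' => s'.
by rewrite pres_clP !pres_clM pres_clP; apply/pres_clE/cong_cmpPr.
Qed.

Definition presented : lincat k :=
  @Lincat k V (fun x y => pm_quot (pres_hom x y))
    (fun x => pres_cl (tid x)) pres_cmp
    pres_cmp1m pres_cmpm1 pres_cmpA pres_cmpPl pres_cmpPr.

End Presentation.

Arguments tid {k V Q} x.
Arguments tzero {k V Q} x y.

Section Annihilate.
Variables (k : fieldType) (C : lincat k) (Z : set C).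

(* In a k-linear category an object is a zero object iff its identity is 0;
   hence setting the objects in Z isomorphic to zero means dividing by the
   two-sided ideal generated by their identities. *)
Inductive null : forall x y : C, hom x y -> Prop :=
| null_id x : Z x -> null (idm x)
| null0 x y : null (0 : hom x y)
| nullP x y a (f g : hom x y) : null f -> null g -> null (a *: f + g)
| null_cmpl x y z (g : hom y z) (f : hom x y) : null f -> null (cmp g f)
| null_cmpr x y z (g : hom y z) (f : hom x y) : null g -> null (cmp g f).

Definition null_eqv x y (f g : hom x y) : Prop := null (f - g).

Lemma nullD x y (f g : hom x y) : null f -> null g -> null (f + g).
Proof. by move=> nf ng; rewrite -[f]scale1r; apply: nullP. Qed.

Lemma nullZ x y a (f : hom x y) : null f -> null (a *: f).
Proof. by move=> nf; rewrite -[_ *: _]addr0; apply: nullP => //; apply: null0. Qed.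

Lemma null_eq x y (f g : hom x y) : f = g -> null_eqv f g.
Proof. by move=> ->; rewrite /null_eqv subrr; apply: null0. Qed.

Fact null_sym x y (f g : hom x y) : null_eqv f g -> null_eqv g f.
Proof. by move=> /(nullZ (-1)); rewrite scaleN1r opprB. Qed.

Fact null_trans x y (f g h : hom x y) :
  null_eqv f g -> null_eqv g h -> null_eqv f h.
Proof. by move=> fg gh; have := nullD fg gh; rewrite addrA subrK. Qed.

Fact null_add x y (f f' g g' : hom x y) :
  null_eqv f f' -> null_eqv g g' -> null_eqv (f + g) (f' + g').
Proof. by move=> ff gg; have := nullD ff gg; rewrite addrACA -opprD. Qed.

Fact null_scale x y a (f f' : hom x y) :
  null_eqv f f' -> null_eqv (a *: f) (a *: f').
Proof. by move=> ff; rewrite /null_eqv -scalerBr; apply: nullZ. Qed.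

Definition ann_hom x y : premodule k :=
  @Premodule k (hom x y) 0 +%R (fun a f => a *: f) (@null_eqv x y)
    (fun f => null_eq (erefl f)) (@null_sym x y) (@null_trans x y)
    (@null_add x y) (@null_scale x y)
    (fun f g h => null_eq (addrA f g h))
    (fun f g => null_eq (addrC f g))
    (fun f => null_eq (add0r f))
    (fun f => null_eq (etrans (congr1 (+%R^~ f) (scaleN1r f)) (addNr f)))
    (fun a b f => null_eq (scalerA a b f))
    (fun f => null_eq (scale1r f))
    (fun a f g => null_eq (scalerDr a f g))
    (fun a b f => null_eq (scalerDl f a b)).

Definition ann_cl x y (f : hom x y) : pm_quot (ann_hom x y) :=
  pm_cl (f : ann_hom x y).

Definition ann_cmp x y z (g : pm_quot (ann_hom y z))
    (f : pm_quot (ann_hom x y)) : pm_quot (ann_hom x z) :=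
  ann_cl (cmp (pm_repr g : hom y z) (pm_repr f : hom x y)).

Lemma ann_clE x y (f g : hom x y) : ann_cl f = ann_cl g <-> null (f - g).
Proof. exact: (@pm_clP k (ann_hom x y)). Qed.

Lemma ann_clM x y z (g : hom y z) (f : hom x y) :
  ann_cmp (ann_cl g) (ann_cl f) = ann_cl (cmp g f).
Proof.
apply/ann_clE.
set g' : hom y z := pm_repr (ann_cl g); set f' : hom x y := pm_repr (ann_cl f).
have ng : null (g' - g) by apply: (@pm_repr_cl k (ann_hom y z) g).
have nf : null (f' - f) by apply: (@pm_repr_cl k (ann_hom x y) f).
have -> : cmp g' f' - cmp g f = cmp g' (f' - f) + cmp (g' - g) f.
  have -> : f' - f = (-1) *: f + f' by rewrite scaleN1r addrC.
  have -> : g' - g = (-1) *: g + g' by rewrite scaleN1r addrC.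
  by rewrite cmpPl cmpPr !scaleN1r [- cmp g' f + _]addrC [- _ + _]addrC addrA subrK.
by apply: nullD; [apply: null_cmpl | apply: null_cmpr].
Qed.

Lemma ann_clP x y a (f g : hom x y) :
  a *: ann_cl f + ann_cl g = ann_cl (a *: f + g).
Proof. exact/esym/(@pm_cl_lin k (ann_hom x y)). Qed.

Lemma ann_quotW x y (P : pm_quot (ann_hom x y) -> Prop) :
  (forall f : hom x y, P (ann_cl f)) -> forall q, P q.
Proof. exact: (@pm_quotW k (ann_hom x y)). Qed.

Fact ann_cmp1m x y (f : pm_quot (ann_hom x y)) :
  ann_cmp (ann_cl (idm y)) f = f.
Proof. by elim/ann_quotW: f => f; rewrite ann_clM cmp1m. Qed.

Fact ann_cmpm1 x y (f : pm_quot (ann_hom x y)) :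
  ann_cmp f (ann_cl (idm x)) = f.
Proof. by elim/ann_quotW: f => f; rewrite ann_clM cmpm1. Qed.

Fact ann_cmpA w x y z (h : pm_quot (ann_hom y z))
    (g : pm_quot (ann_hom x y)) (f : pm_quot (ann_hom w x)) :
  ann_cmp h (ann_cmp g f) = ann_cmp (ann_cmp h g) f.
Proof.
elim/ann_quotW: h => h; elim/ann_quotW: g => g; elim/ann_quotW: f => f.
by rewrite !ann_clM cmpA.
Qed.

Fact ann_cmpPl x y z a (g g' : pm_quot (ann_hom y z))
    (f : pm_quot (ann_hom x y)) :
  ann_cmp (a *: g + g') f = a *: ann_cmp g f + ann_cmp g' f.
Proof.
elim/ann_quotW: g => g; elim/ann_quotW: g' => g'; elim/ann_quotW: f => f.
by rewrite ann_clP !ann_clM ann_clP cmpPl.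
Qed.

Fact ann_cmpPr x y z a (g : pm_quot (ann_hom y z))
    (f f' : pm_quot (ann_hom x y)) :
  ann_cmp g (a *: f + f') = a *: ann_cmp g f + ann_cmp g f'.
Proof.
elim/ann_quotW: g => g; elim/ann_quotW: f => f; elim/ann_quotW: f' => f'.
by rewrite ann_clP !ann_clM ann_clP cmpPr.
Qed.

Definition annihilate : lincat k :=
  @Lincat k C (fun x y => pm_quot (ann_hom x y))
    (fun x => ann_cl (idm x)) ann_cmp
    ann_cmp1m ann_cmpm1 ann_cmpA ann_cmpPl ann_cmpPr.

End Annihilate.

Section Lambda.
Variables (R : realType) (k : closedFieldType).

(* [Some x] is the real number x, [None] the additional zero object.
   [gup] is alpha_{yx} and [gdn] is alpha^*_{xy}; the convention for x = y is
   imposed by relations. *)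
Inductive gen : option R -> option R -> Type :=
| gup (x y : R) of x <= y : gen (Some x) (Some y)
| gdn (x y : R) of x <= y : gen (Some y) (Some x).

Definition tup (x y : R) (h : x <= y) : term k gen (Some x) (Some y) :=
  tgen k (gup h).

Definition tdn (x y : R) (h : x <= y) : term k gen (Some y) (Some x) :=
  tgen k (gdn h).

Inductive lambda_rel : forall x y, term k gen x y -> term k gen x y -> Prop :=
| rel_zero_object : lambda_rel (tid None) (tzero None None)
| rel_up_refl x (h : x <= x) : lambda_rel (tup h) (tid (Some x))
| rel_dn_refl x (h : x <= x) : lambda_rel (tdn h) (tid (Some x))
| rel_up x y z (xy : x <= y) (yz : y <= z) (xz : x <= z) :
    lambda_rel (tcmp (tup yz) (tup xy)) (tup xz)
| rel_dn x y z (xy : x <= y) (yz : y <= z) (xz : x <= z) :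
    lambda_rel (tcmp (tdn xy) (tdn yz)) (tdn xz)
| rel_square x a b of 0 < a & 0 < b :
    forall (h1 : x <= x + a) (h2 : x + a - b <= x + a)
           (h3 : x - b <= x) (h4 : x - b <= x + a - b),
    lambda_rel (tcmp (tdn h2) (tup h1)) (tcmp (tup h4) (tdn h3)).

Definition LambdaR : lincat k := presented lambda_rel.

Definition outside01 : set LambdaR :=
  Some @` [set x : R | ~~ (0 < x < 1)].

Definition Lambda : lincat k := annihilate outside01.

Definition pt (x : R) : Lambda := Some x.

Definition alpha (x y : R) (h : x <= y) : hom (pt x) (pt y) :=
  ann_cl outside01 (pres_cl lambda_rel (tup h) : hom (_ : LambdaR) _).

Definition alphas (x y : R) (h : x <= y) : hom (pt y) (pt x) :=
  ann_cl outside01 (pres_cl lambda_rel (tdn h) : hom (_ : LambdaR) _).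

(* [composite f l]: f is a composition of alphas and alpha-stars whose lengths
   add up to l. *)
Inductive composite (x : R) : forall y : R, hom (pt x) (pt y) -> R -> Prop :=
| composite_id : composite (idm (pt x)) 0
| composite_up y z (h : y <= z) (f : hom (pt x) (pt y)) l :
    composite f l -> composite (cmp (alpha h) f) (l + (z - y))
| composite_dn y z (h : z <= y) (f : hom (pt x) (pt y)) l :
    composite f l -> composite (cmp (alphas h) f) (l + (y - z)).

(* "f is path like, of length l" *)
Definition path_like x y (f : hom (pt x) (pt y)) (l : R) : Prop :=
  composite f l /\ f <> 0.

Definition projective (x : R) : catmodule Lambda := representable (pt x).

Definition I01 : Type := {y : R | 0 <= y <= 1}.

Definition i0 : I01 := exist _ 0 (introT andP (conj (lexx 0) ler01)).

Definition i1 : I01 := exist _ 1 (introT andP (conj ler01 (lexx 1))).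

Definition nonzero_at x (M : submodule (projective x)) (y : R) : Prop :=
  exists f : hom (pt x) (pt y), M (pt y) f /\ f <> 0.

Definition bdry_up x (M : submodule (projective x)) (y : I01) : R :=
  if sval y == 0 then x
  else if sval y == 1 then 1 - x
  else if `[< nonzero_at M (sval y) >]
  then inf [set l | exists f : hom (pt x) (pt (sval y)),
                      M (pt (sval y)) f /\ path_like f l]
  else sup [set l | exists f : hom (pt x) (pt (sval y)), path_like f l].

Definition decorous x (M : submodule (projective x)) : Prop :=
  forall y : I01, 0 < sval y < 1 -> nonzero_at M (sval y) ->
    exists f : hom (pt x) (pt (sval y)),
      M (pt (sval y)) f /\ path_like f (bdry_up M y).

(* The submodules are tagged by x, so that e.g. the zero submodules of P_x
   and P_x' are distinct for x <> x'. *)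
Definition decorous_submodules : set {x : R & submodule (projective x)} :=
  [set M | 0 < tag M < 1 /\ decorous (tagged M)].

Definition bdry : set (I01 -> R) :=
  [set d | (forall y z, `|d y - d z| <= `|sval y - sval z|) /\
           d i1 <> d i0 + 1 /\ d i1 <> d i0 - 1].

Definition bdry_sim (d d' : I01 -> R) : Prop :=
  exists a : R, forall y, d y = d' y + a.

Definition bdry_class (d : I01 -> R) : set (I01 -> R) :=
  [set d' | bdry d' /\ bdry_sim d d'].

Definition bdry_quotient : set (set (I01 -> R)) := [set bdry_class d | d in bdry].

End Lambda.

Arguments projective {R} k x.
Arguments decorous_submodules R k _ : clear implicits.
Arguments bdry_quotient R _ : clear implicits.

(* Main.v *)
Require Import Defs.
From mathcomp Require Import all_boot all_order all_algebra.
From mathcomp Require Import boolp classical_sets functions reals.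
From mathcomp Require Import ring lra.
(* The vector spaces also come with a [hom]; the one of [lincat] is meant. *)
Import Defs.

Set Implicit Arguments.
Unset Strict Implicit.
Unset Printing Implicit Defensive.

(** The square relation of Lambda_R lets every composition of alphas and
    alpha-stars from [x] to [y] be rearranged into one ascent followed by one
    descent, or one descent followed by one ascent, so a composition is
    determined by its length [l]: it is [lpath x y l], with [l >= |x - y|].
    It peaks at [(x + y + l) / 2] and bottoms out at [(x + y - l) / 2], hence it
    dies in the quotient as soon as [l >= min (x + y) (2 - x - y)], the number
    [len_bound x y].

    The paths with [|x - y| <= l < len_bound x y] form a basis of
    [Hom (x, y)].  They span, by induction on terms ([hom_path_span]).  For
    independence, a morphism is made to act on functions [R -> k], a generator
    of length [l] translating them by [l].  This respects all relations of
    Lambda_R, any morphism from [x] to [y] raises supports by at least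
    [|x - y|], and a morphism of the ideal that is divided out raises them by
    at least [len_bound x y] ([null_raises_by_bound]).  Applying a morphism to
    the indicator function of 0 and reading the value at [l < len_bound x y]
    therefore gives a well-defined linear coefficient [coef _ l] on the
    quotient, dual to the paths.

    A submodule of [P_x] is monomial: with a morphism it contains every path
    that occurs in it ([sub_coef]), because the shortest such path can be
    isolated up to terms that compositions with loops make longer and
    eventually zero.  So [M(y)] is the span of the paths whose lengths lie in an
    up-closed set, and M is decorous exactly when these sets are
    [{l | l >= b(y)}], with [b] the boundary of M ([mem_decorous]); when
    [M(y) = 0] the convention [b(y) = len_bound x y] keeps this true.
    Stability under the alphas and alpha-stars amounts to [b] being 1-Lipschitz,
    and the values [x] and [1 - x] at the ends of the interval correspond to
    the bounds [|x - y| <= b(y) <= len_bound x y].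

    Conversely a 1-Lipschitz function with those end values gives back a
    decorous submodule ([bdry_up_sub_above]).  An arbitrary [d] has exactly one
    translate of this kind: [d(0) + a = x] and [d(1) + a = 1 - x] force
    [x = (1 + d(0) - d(1)) / 2], which lies strictly between 0 and 1 precisely
    when [d(1) - d(0)] lies strictly between -1 and 1. *)

Import Order.TTheory GRing.Theory Num.Theory.

Local Open Scope classical_set_scope.
Local Open Scope ring_scope.

(** * Linear categories *)
Section Lincat.
Variables (k : fieldType) (C : lincat k).

Lemma cmp0m (x y z : C) (f : hom x y) : cmp (0 : hom y z) f = 0.
Proof.
by have := cmpPl (-1) (0 : hom y z) 0 f; rewrite scaler0 addr0 scaleN1r addNr.
Qed.

Lemma cmpm0 (x y z : C) (g : hom y z) : cmp g (0 : hom x y) = 0.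
Proof.
by have := cmpPr (-1) g (0 : hom x y) 0; rewrite scaler0 addr0 scaleN1r addNr.
Qed.

Lemma hom_to_zero (x y : C) (f : hom x y) : idm y = 0 -> f = 0.
Proof. by move=> y0; rewrite -[f]cmp1m y0 cmp0m. Qed.

Lemma hom_from_zero (x y : C) (f : hom x y) : idm x = 0 -> f = 0.
Proof. by move=> x0; rewrite -[f]cmpm1 x0 cmpm0. Qed.

Lemma cmp_sumr (x y z : C) (I : eqType) (r : seq I) (c : I -> k)
    (g : hom y z) (f : I -> hom x y) :
  cmp g (\sum_(i <- r) c i *: f i) = \sum_(i <- r) c i *: cmp g (f i).
Proof.
by elim: r => [|i r IHr]; rewrite ?big_nil ?cmpm0 // !big_cons cmpPr IHr.
Qed.

Lemma cmp_suml (x y z : C) (I : eqType) (r : seq I) (c : I -> k)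
    (g : I -> hom y z) (f : hom x y) :
  cmp (\sum_(i <- r) c i *: g i) f = \sum_(i <- r) c i *: cmp (g i) f.
Proof.
by elim: r => [|i r IHr]; rewrite ?big_nil ?cmp0m // !big_cons cmpPl IHr.
Qed.

End Lincat.

(** * Coefficients of morphisms *)
Section Eval.
Variables (R : realType) (k : closedFieldType).
Implicit Types (v w : R -> k) (l m s : R) (x y z : R).

Definition gen_length (X Y : option R) (q : gen X Y) : R :=
  match q with gup x y _ => y - x | gdn x y _ => y - x end.

(** The zero object acts by 0, so that the relation killing its identity
    holds. *)
Fixpoint shift_term (X Y : option R) (t : term k (@gen R) X Y) :
    (R -> k) -> R -> k :=
  match t with
  | tgen _ _ q => fun v m => v (m - gen_length q)
  | tid X => fun v m => if X is Some _ then v m else 0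
  | tcmp _ _ _ t s => fun v => shift_term t (shift_term s v)
  | tzero _ _ => fun _ _ => 0
  | tadd _ _ s t => fun v m => shift_term s v m + shift_term t v m
  | tscale _ _ a s => fun v m => a * shift_term s v m
  end.

Lemma shift_termP (X Y : option R) (t : term k (@gen R) X Y) a v w :
  shift_term t (fun m => a * v m + w m) =
  (fun m => a * shift_term t v m + shift_term t w m).
Proof.
elim: X Y / t v w => //=.
- by move=> [x|] v w; apply/funext=> m //; rewrite mulr0 addr0.
- by move=> ? ? ? t IHt s IHs v w; rewrite IHs IHt.
- by move=> ? ? v w; apply/funext=> m; rewrite mulr0 addr0.
- by move=> ? ? s IHs t IHt v w; apply/funext=> m; rewrite IHs IHt; ring.
- by move=> ? ? b s IHs v w; apply/funext=> m; rewrite IHs; ring.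
Qed.

Lemma shift_term0 (X Y : option R) (t : term k (@gen R) X Y) :
  shift_term t (fun=> 0) = (fun=> 0).
Proof.
elim: X Y / t => //=.
- by move=> [x|].
- by move=> ? ? ? t IHt s IHs; rewrite IHs IHt.
- by move=> ? ? s IHs t IHt; rewrite IHs IHt addr0.
- by move=> ? ? b s IHs; rewrite IHs mulr0.
Qed.

Lemma shift_term_None (X Y : option R) (t : term k (@gen R) X Y) v :
  X = None \/ Y = None -> shift_term t v = (fun=> 0).
Proof.
elim: X Y / t v => //=.
- by move=> X Y q v; case: q => [x y xy|x y xy] [].
- by move=> [x|] v [].
- move=> X Y Z t IHt s IHs v [X0|Z0]; last by rewrite IHt //; right.
  by rewrite IHs ?shift_term0 //; left.
- by move=> X Y s IHs t IHt v XY0; rewrite IHs // IHt // addr0.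
- by move=> X Y b s IHs v XY0; rewrite IHs // mulr0.
Qed.

(** Both sides of each relation of Lambda_R have the same total length, and
    translations compose by adding lengths. *)
Lemma shift_term_cong (X Y : option R) (s t : term k (@gen R) X Y) :
  cong (@lambda_rel R k) s t -> forall v, shift_term s v = shift_term t v.
Proof.
elim=> {X Y s t} //=.
- move=> X Y s t [] //=.
  + by move=> x h v; apply/funext=> m; rewrite subrr subr0.
  + by move=> x h v; apply/funext=> m; rewrite subrr subr0.
  + by move=> x y z _ _ _ v; apply/funext=> m; congr v; ring.
  + by move=> x y z _ _ _ v; apply/funext=> m; congr v; ring.
  + by move=> x a b _ _ _ _ _ _ v; apply/funext=> m; congr v; ring.
- by move=> X Y s t u _ IH1 _ IH2 v; rewrite IH1.
- by move=> X Y Z t t' s s' _ IHt _ IHs v; rewrite IHs IHt.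
- by move=> X Y s s' t t' _ IHs _ IHt v; rewrite IHs IHt.
- by move=> X Y a s s' _ IHs v; rewrite IHs.
- by move=> X Y s t u v; apply/funext=> m; rewrite addrA.
- by move=> X Y s t v; apply/funext=> m; rewrite addrC.
- by move=> X Y s v; apply/funext=> m; rewrite add0r.
- by move=> X Y s v; apply/funext=> m; rewrite mulN1r addNr.
- by move=> X Y a b s v; apply/funext=> m; rewrite mulrA.
- by move=> X Y s v; apply/funext=> m; rewrite mul1r.
- by move=> X Y a s t v; apply/funext=> m; rewrite mulrDr.
- by move=> X Y a b s v; apply/funext=> m; rewrite mulrDl.
- move=> X [y|] s v //=; rewrite (@shift_term_None _ _ s); last by right.
  by [].
- move=> [x|] Y s v //=; rewrite !(@shift_term_None _ _ s) //; by left.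
- by move=> X Y Z a t s s' v; rewrite shift_termP.
Qed.

Definition vanishes_below s v := forall m, m < s -> v m = 0.

Definition odist (X Y : option R) : R :=
  if (X, Y) is (Some x, Some y) then `|x - y| else 0.

Lemma odist_triangle (X Z : option R) y :
  odist X Z <= odist X (Some y) + odist (Some y) Z.
Proof.
by case: X Z => [x|] [z|]; rewrite /odist ?ler_distD ?addr0 ?add0r ?addr_ge0.
Qed.

Lemma shift_term_dist (X Y : option R) (t : term k (@gen R) X Y) s v :
  vanishes_below s v -> vanishes_below (s + odist X Y) (shift_term t v).
Proof.
elim: X Y / t s v => //=.
- move=> X Y [x y xy|x y xy] s v v0 m; rewrite /odist /= => lt_m; apply: v0.
  + by move: lt_m; rewrite distrC ger0_norm ?subr_ge0 //; lra.
  + by move: lt_m; rewrite ger0_norm ?subr_ge0 //; lra.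
- move=> [x|] s v v0 m // lt_m; apply: v0.
  by rewrite /odist subrr normr0 addr0 in lt_m.
- move=> X [y|] Z t IHt u IHu s v v0 m lt_m; last first.
    by rewrite (@shift_term_None _ _ u) ?shift_term0 //; right.
  apply: (IHt _ _ (IHu _ _ v0)); apply: (lt_le_trans lt_m).
  by rewrite -addrA lerD2l odist_triangle.
- move=> X Y s1 IH1 s2 IH2 s v v0 m lt_m.
  by rewrite (IH1 s) // (IH2 s) // addr0.
- by move=> X Y a s1 IH1 s v v0 m lt_m; rewrite (IH1 s) // mulr0.
Qed.

(** The supremum of the lengths of nonzero paths from [x] to [y]: a path of
    length [l] stays between [(x + y - l) / 2] and [(x + y + l) / 2]. *)
Definition len_bound x y : R := Num.min (x + y) (2 - x - y).

Definition shift_hom (X Y : LambdaR R k) (f : hom X Y) : (R -> k) -> R -> k :=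
  shift_term (pm_repr (f : pm_quot (pres_hom (@lambda_rel R k) X Y))).

Lemma shift_hom_cl (X Y : option R) (t : term k (@gen R) X Y) :
  shift_hom (pres_cl (@lambda_rel R k) t : hom (X : LambdaR R k) Y) =
  shift_term t.
Proof.
apply/funext=> v; apply: shift_term_cong.
exact: (@pm_repr_cl k (pres_hom (@lambda_rel R k) X Y) t).
Qed.

Lemma shift_homP (X Y : LambdaR R k) a (f g : hom X Y) v m :
  shift_hom (a *: f + g) v m = a * shift_hom f v m + shift_hom g v m.
Proof.
elim/pres_quotW: f => s; elim/pres_quotW: g => t.
by rewrite pres_clP !shift_hom_cl.
Qed.

Lemma shift_hom_cmp (X Y Z : LambdaR R k) (g : hom Y Z) (f : hom X Y) v :
  shift_hom (cmp g f) v = shift_hom g (shift_hom f v).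
Proof.
elim/pres_quotW: f => s; elim/pres_quotW: g => t.
by rewrite /cmp /= pres_clM !shift_hom_cl.
Qed.

Lemma shift_hom0 (X Y : LambdaR R k) v : shift_hom (0 : hom X Y) v = fun=> 0.
Proof.
by rewrite -[0]/(pres_cl (@lambda_rel R k) (tzero X Y) : hom X Y) shift_hom_cl.
Qed.

(** The zero object carries no condition: every morphism through it acts
    by 0. *)
Definition raises_by_bound (X Y : LambdaR R k) (f : hom X Y) : Prop :=
  match X, Y with
  | Some x, Some y => forall s v, vanishes_below s v ->
      vanishes_below (s + len_bound x y) (shift_hom f v)
  | _, _ => True
  end.

Lemma shift_hom_None (X Y : LambdaR R k) (f : hom X Y) v :
  X = None \/ Y = None -> shift_hom f v = fun=> 0.
Proof.
by elim/pres_quotW: f => t; rewrite shift_hom_cl; apply: shift_term_None.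
Qed.

Lemma shift_hom_const0 (X Y : LambdaR R k) (f : hom X Y) :
  shift_hom f (fun=> 0) = fun=> 0.
Proof. by elim/pres_quotW: f => t; rewrite shift_hom_cl; apply: shift_term0. Qed.

Lemma shift_hom_dist x y
    (f : hom (Some x : LambdaR R k) (Some y : LambdaR R k)) s v :
  vanishes_below s v -> vanishes_below (s + `|x - y|) (shift_hom f v).
Proof.
elim/pres_quotW: f => t v0; rewrite shift_hom_cl.
exact: (shift_term_dist t v0).
Qed.

Lemma vanishes_below_le s s' v :
  s' <= s -> vanishes_below s v -> vanishes_below s' v.
Proof. by move=> le_s v0 m lt_m; apply: v0; apply: lt_le_trans le_s. Qed.

Lemma len_bound_dist x y z : len_bound x z <= len_bound x y + `|y - z|.
Proof.
rewrite /len_bound; case: (ger0P (y - z)) => h;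
case: (leP (x + z)) => h1; case: (leP (x + y)) => h2; lra.
Qed.

Lemma len_boundC x y : len_bound x y = len_bound y x.
Proof. by rewrite /len_bound; congr Num.min; ring. Qed.

(** For [x] outside (0,1) one has [len_bound x x <= 0], so the identity of [x]
    qualifies; composing with a morphism [y -> z] raises supports further by
    [|y - z|], which covers the variation of [len_bound]. *)
Lemma null_raises_by_bound (X Y : LambdaR R k) (f : hom X Y) :
  null (@outside01 R k) f -> raises_by_bound f.
Proof.
elim=> {X Y f}.
- move=> _ [x /negP xout <-] s v v0 /=; rewrite shift_hom_cl /=.
  apply: vanishes_below_le v0; rewrite gerDl /len_bound ge_min; apply/orP.
  case: (ltP 0 x) xout => /= x0; last by left; lra.
  by case: ltP => // x1 _; right; lra.
- by move=> [x|] [y|] //= s v _ m _; rewrite shift_hom0.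
- move=> [x|] [y|] a f g //= _ IHf _ IHg s v v0 m lt_m.
  by rewrite shift_homP (IHf s) // (IHg s) // mulr0 addr0.
- move=> [x|] [y|] [z|] g f _ //= IHf s v v0; rewrite shift_hom_cmp.
    apply: vanishes_below_le (shift_hom_dist g (IHf _ _ v0)).
    by rewrite -addrA lerD2l len_bound_dist.
  by rewrite (@shift_hom_None _ _ f) ?shift_hom_const0; [move=> ? ?|right].
- move=> [x|] [y|] [z|] g f _ //= IHg s v v0; rewrite shift_hom_cmp.
    apply: vanishes_below_le (IHg _ _ (shift_hom_dist f v0)).
    rewrite -addrA lerD2l addrC len_boundC [len_bound y z]len_boundC distrC.
    exact: len_bound_dist.
  by rewrite (@shift_hom_None _ _ f) ?shift_hom_const0; [move=> ? ?|right].
Qed.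

(** From [len_bound] on the value read off a representative depends on the
    representative; setting it to 0 there makes [coef f] a function of [f]. *)
Definition coef x y (f : hom (pt k x) (pt k y)) (l : R) : k :=
  if l < len_bound x y then
    shift_hom (pm_repr (f : pm_quot (ann_hom (@outside01 R k) _ _))
          : hom (Some x : LambdaR R k) (Some y : LambdaR R k))
      (fun m => (m == 0)%:R) l
  else 0.

Lemma coef_cl x y (f : hom (Some x : LambdaR R k) (Some y : LambdaR R k)) l :
  coef (ann_cl (@outside01 R k) f) l =
  if l < len_bound x y then shift_hom f (fun m => (m == 0)%:R) l else 0.
Proof.
rewrite /coef; case: ifP => // l_lt.
set f' := (X in shift_hom X).
have nf : null (@outside01 R k) (f' - f).
  exact: (@pm_repr_cl k (ann_hom (@outside01 R k) (Some x) (Some y)) f).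
have -> : f' = 1 *: f + (f' - f) by rewrite scale1r addrC subrK.
have raise_f : forall s v, vanishes_below s v ->
    vanishes_below (s + len_bound x y) (shift_hom (f' - f) v).
  exact: null_raises_by_bound nf.
rewrite shift_homP mul1r (raise_f 0) ?addr0 ?add0r //.
by move=> m m0; rewrite lt_eqF.
Qed.

Lemma coefP x y a (f g : hom (pt k x) (pt k y)) l :
  coef (a *: f + g) l = a * coef f l + coef g l.
Proof.
elim/ann_quotW: f => f; elim/ann_quotW: g => g.
rewrite ann_clP !coef_cl; case: ifP => // _; last by rewrite mulr0 addr0.
by rewrite shift_homP.
Qed.

Lemma coef_ge_bound x y (f : hom (pt k x) (pt k y)) l :
  len_bound x y <= l -> coef f l = 0.
Proof. by rewrite /coef leNgt => /negbTE ->. Qed.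

Lemma coef_lt_dist x y (f : hom (pt k x) (pt k y)) l :
  l < `|x - y| -> coef f l = 0.
Proof.
elim/ann_quotW: f => f lt_l; rewrite coef_cl; case: ifP => // _.
rewrite (@shift_hom_dist x y f 0) ?add0r // => m m0.
by rewrite lt_eqF.
Qed.

End Eval.

(** * Paths are determined by their lengths *)
Section Paths.
Variables (R : realType) (k : closedFieldType).
Implicit Types (l m s : R) (x y z u w : R).

Local Notation L := (LambdaR R k).

Lemma alpha_refl x (h : x <= x) : alpha k h = idm (pt k x).
Proof.
by congr ann_cl; apply/pres_clE/cong_rel/rel_up_refl.
Qed.

Lemma alphas_refl x (h : x <= x) : alphas k h = idm (pt k x).
Proof.
by congr ann_cl; apply/pres_clE/cong_rel/rel_dn_refl.
Qed.

Lemma cmp_ann (X Y Z : L) (g : hom Y Z) (f : hom X Y) :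
  cmp (ann_cl (@outside01 R k) g : hom (Y : Lambda R k) (Z : Lambda R k))
      (ann_cl (@outside01 R k) f : hom (X : Lambda R k) (Y : Lambda R k)) =
  ann_cl (@outside01 R k) (cmp g f).
Proof. exact: ann_clM. Qed.

Lemma cmp_pres (X Y Z : L) (t : term k (@gen R) Y Z) (s : term k (@gen R) X Y) :
  cmp (pres_cl (@lambda_rel R k) t : hom (Y : L) (Z : L))
      (pres_cl (@lambda_rel R k) s : hom (X : L) (Y : L)) =
  pres_cl (@lambda_rel R k) (tcmp t s).
Proof. exact: pres_clM. Qed.

Lemma alpha_alpha x y z (xy : x <= y) (yz : y <= z) (xz : x <= z) :
  cmp (alpha k yz) (alpha k xy) = alpha k xz.
Proof.
rewrite [LHS]cmp_ann cmp_pres; congr ann_cl; exact/pres_clE/cong_rel/rel_up.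
Qed.

Lemma alphas_alphas x y z (xy : x <= y) (yz : y <= z) (xz : x <= z) :
  cmp (alphas k xy) (alphas k yz) = alphas k xz.
Proof.
rewrite [LHS]cmp_ann cmp_pres; congr ann_cl; exact/pres_clE/cong_rel/rel_dn.
Qed.

(** The square relation without its positivity assumptions: in the degenerate
    cases one of the two generators on each side is an identity.  The equation
    on the corners avoids transport along equalities of objects. *)
Lemma square x u y w (xu : x <= u) (yu : y <= u) (wx : w <= x) (wy : w <= y) :
  u + w = x + y ->
  cmp (alphas k yu) (alpha k xu) = cmp (alpha k wy) (alphas k wx).
Proof.
move=> uwxy; have [xu0|xu_neq] := eqVneq x u.
  subst u; have yw : y = w by lra.
  subst y; rewrite !alpha_refl cmpm1 cmp1m; congr (alphas k _).
  exact: bool_irrelevance.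
have [xw0|xw_neq] := eqVneq x w.
  subst w; have yw : y = u by lra.
  subst y; rewrite !alphas_refl cmpm1 cmp1m; congr (alpha k _).
  exact: bool_irrelevance.
have a0 : 0 < u - x by rewrite subr_gt0 lt_neqAle xu_neq.
have b0 : 0 < x - w by rewrite subr_gt0 lt_neqAle eq_sym xw_neq.
move: (u - x) (x - w) (subrKC x u) (subKr x w) a0 b0 => a b ua wb a0 b0.
have yab : y = x + a - b by lra.
subst u w y; rewrite [LHS]cmp_ann [RHS]cmp_ann !cmp_pres; congr ann_cl.
exact/pres_clE/cong_rel/rel_square.
Qed.

(** The maximum with [x] and [y] is inert for [|x - y| <= l]; it provides an
    ascent and a descent for every [l], so that [lpath] is total. *)
Definition apex x y l : R := Num.max (Num.max x y) ((l + x + y) / 2).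

Lemma apex_ger x y l : x <= apex x y l.
Proof. by rewrite /apex !le_max lexx. Qed.

Lemma apex_gel x y l : y <= apex x y l.
Proof. by rewrite /apex !le_max lexx orbT. Qed.

Definition lpath x y l : hom (pt k x) (pt k y) :=
  cmp (alphas k (apex_gel x y l)) (alpha k (apex_ger x y l)).

Lemma lpath_up_down x y u (xu : x <= u) (yu : y <= u) l :
  l = (u - x) + (u - y) ->
  cmp (alphas k yu) (alpha k xu) = lpath x y l.
Proof.
move=> ->.
have apexE : apex x y ((u - x) + (u - y)) = u.
  rewrite /apex max_r; first by field.
  by rewrite ge_max; apply/andP; split; lra.
rewrite /lpath; move: (apex_gel _ _ _) (apex_ger _ _ _); rewrite apexE => h1 h2.
by congr (cmp (alphas k _) (alpha k _)); apply: bool_irrelevance.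
Qed.

Lemma dist_sides x y l : `|x - y| <= l -> x - y <= l /\ y - x <= l.
Proof. by rewrite ler_norml => /andP[? ?]; split; lra. Qed.

Lemma lpath_down_up x y w (wx : w <= x) (wy : w <= y) l :
  l = (x - w) + (y - w) ->
  cmp (alpha k wy) (alphas k wx) = lpath x y l.
Proof.
move=> ->; have xu : x <= x + y - w by lra.
have yu : y <= x + y - w by lra.
rewrite -(square xu yu); last by ring.
by apply: lpath_up_down; ring.
Qed.

Lemma lpath_peak x y l : `|x - y| <= l ->
  exists (u : R) (xu : x <= u) (yu : y <= u),
  u = (l + x + y) / 2 /\ lpath x y l = cmp (alphas k yu) (alpha k xu).
Proof.
move=> /dist_sides[xy yx]; exists ((l + x + y) / 2).
have xu : x <= (l + x + y) / 2 by lra.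
have yu : y <= (l + x + y) / 2 by lra.
exists xu, yu; split=> //.
by symmetry; apply: lpath_up_down; field.
Qed.

Lemma lpath_valley x y l : `|x - y| <= l ->
  exists (w : R) (wx : w <= x) (wy : w <= y),
  w = (x + y - l) / 2 /\ lpath x y l = cmp (alpha k wy) (alphas k wx).
Proof.
move=> /dist_sides[xy yx]; exists ((x + y - l) / 2).
have xu : (x + y - l) / 2 <= x by lra.
have yu : (x + y - l) / 2 <= y by lra.
exists xu, yu; split=> //.
by symmetry; apply: lpath_down_up; field.
Qed.

(** Descending first, the path ends with an ascent, which absorbs the new
    one. *)
Lemma alpha_lpath x y z (yz : y <= z) l : `|x - y| <= l ->
  cmp (alpha k yz) (lpath x y l) = lpath x z (l + (z - y)).
Proof.
move=> /lpath_valley[w [wx [wy [wE ->]]]].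
have wz := le_trans wy yz.
rewrite cmpA (alpha_alpha _ _ wz); apply: lpath_down_up.
by rewrite wE; field.
Qed.

Lemma alphas_lpath x y z (zy : z <= y) l : `|x - y| <= l ->
  cmp (alphas k zy) (lpath x y l) = lpath x z (l + (y - z)).
Proof.
move=> /lpath_peak[u [xu [yu [uE ->]]]].
have zu := le_trans zy yu.
rewrite cmpA (alphas_alphas _ _ zu); apply: lpath_up_down.
by rewrite uE; field.
Qed.

Lemma lpath0 x : lpath x x 0 = idm (pt k x).
Proof.
rewrite -(lpath_up_down (lexx x) (lexx x)); last by ring.
by rewrite alpha_refl alphas_refl cmp1m.
Qed.

Lemma dist_add x y z l m : `|x - y| <= l -> `|y - z| <= m -> `|x - z| <= l + m.
Proof. by move=> xy yz; apply: le_trans (ler_distD y _ _) (lerD xy yz). Qed.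

Lemma lpath_lpath x y z l m : `|x - y| <= l -> `|y - z| <= m ->
  cmp (lpath y z m) (lpath x y l) = lpath x z (l + m).
Proof.
move=> xy yz; have [u [yu [zu [uE ->]]]] := lpath_peak yz.
rewrite -cmpA alpha_lpath // alphas_lpath.
  by congr (lpath _ _ _); rewrite uE; field.
by apply: (dist_add (y := y)) => //; rewrite distrC ger0_norm ?subr_ge0.
Qed.

Lemma composite_lpath x y (f : hom (pt k x) (pt k y)) l :
  composite f l -> `|x - y| <= l /\ f = lpath x y l.
Proof.
elim=> {y f l}.
- by rewrite subrr normr0 lexx lpath0.
- move=> y z yz f l _ [le_l ->]; rewrite alpha_lpath //; split=> //.
  by apply: (dist_add (y := y)) => //; rewrite distrC ger0_norm ?subr_ge0.
- move=> y z yz f l _ [le_l ->]; rewrite alphas_lpath //; split=> //.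
  by apply: (dist_add (y := y)) => //; rewrite ger0_norm ?subr_ge0.
Qed.

Lemma lpath_composite x y l : `|x - y| <= l -> composite (lpath x y l) l.
Proof.
move=> /lpath_peak[u [xu [yu [uE ->]]]].
have -> : l = 0 + (u - x) + (u - y) by rewrite uE; field.
apply: composite_dn; rewrite -[alpha k xu]cmpm1; apply: composite_up.
exact: composite_id.
Qed.

Lemma idm_outside x : ~~ (0 < x < 1) -> idm (pt k x) = 0.
Proof.
move=> xout; apply/(ann_clE (@outside01 R k)); rewrite subr0; apply: null_id.
by exists x.
Qed.

Lemma idm_None : idm (None : Lambda R k) = 0.
Proof.
have id0 : idm (None : L) = 0 by exact/pres_clE/cong_rel/rel_zero_object.
by rewrite [LHS](congr1 (@ann_cl k L (@outside01 R k) None None) id0).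
Qed.

(** The path factors through its lowest or its highest point, and one of them
    is outside (0,1). *)
Lemma lpath_ge_bound x y l :
  `|x - y| <= l -> len_bound x y <= l -> lpath x y l = 0.
Proof.
rewrite /len_bound ge_min => le_l /orP[le2|le2].
- have [w [wx [wy [wE ->]]]] := lpath_valley le_l.
  rewrite (hom_to_zero (alphas k wx)) ?cmpm0 //; apply: idm_outside.
  by apply/negP => /andP[w0 w1]; lra.
- have [w [wx [wy [wE ->]]]] := lpath_peak le_l.
  rewrite (hom_to_zero (alpha k wx)) ?cmpm0 //; apply: idm_outside.
  by apply/negP => /andP[w0 w1]; lra.
Qed.

Lemma coef_lpath x y l m : `|x - y| <= l -> m < len_bound x y ->
  coef (lpath x y l) m = (m == l)%:R.
Proof.
move=> /lpath_peak[u [xu [yu [uE ->]]]] lt_m.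
rewrite [cmp _ _]cmp_ann coef_cl lt_m cmp_pres shift_hom_cl /= uE.
by congr (nat_of_bool _)%:R; rewrite -[RHS]subr_eq0; congr (_ == 0); field.
Qed.

(** * Paths form a basis of the morphism spaces *)
Inductive path_span x y : hom (pt k x) (pt k y) -> Prop :=
| path_span_lpath l : `|x - y| <= l -> path_span (lpath x y l)
| path_span0 : path_span 0
| path_spanP a f g : path_span f -> path_span g -> path_span (a *: f + g).

Lemma path_span_cmp x y z (g : hom (pt k y) (pt k z))
    (f : hom (pt k x) (pt k y)) :
  path_span g -> path_span f -> path_span (cmp g f).
Proof.
move=> sg sf; elim: sg => [m le_m||a g1 g2 _ IH1 _ IH2].
- elim: sf => [l le_l||a f1 f2 _ IH1 _ IH2].
  + by rewrite lpath_lpath //; apply/path_span_lpath/dist_add; eauto.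
  + by rewrite cmpm0; apply: path_span0.
  + by rewrite cmpPr; apply: path_spanP.
- by rewrite cmp0m; apply: path_span0.
- by rewrite cmpPl; apply: path_spanP.
Qed.

Lemma path_span_alpha x y (h : x <= y) : path_span (alpha k h).
Proof.
rewrite -[alpha k h]cmpm1 -lpath0 alpha_lpath ?subrr ?normr0 //.
by rewrite add0r; apply: path_span_lpath; rewrite distrC ger0_norm ?subr_ge0.
Qed.

Lemma path_span_alphas x y (h : x <= y) : path_span (alphas k h).
Proof.
rewrite -[alphas k h]cmpm1 -lpath0 alphas_lpath ?subrr ?normr0 //.
by rewrite add0r; apply: path_span_lpath; rewrite ger0_norm ?subr_ge0.
Qed.

Definition term_hom (X Y : option R) (t : term k (@gen R) X Y) :
    hom (X : Lambda R k) (Y : Lambda R k) :=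
  ann_cl (@outside01 R k) (pres_cl (@lambda_rel R k) t : hom (X : L) (Y : L)).

Definition spanned (X Y : Lambda R k) : hom X Y -> Prop :=
  match X, Y with
  | Some x, Some y => fun f => @path_span x y f
  | _, _ => fun f => f = 0
  end.

Lemma spannedP (X Y : Lambda R k) a (f g : hom X Y) :
  spanned f -> spanned g -> spanned (a *: f + g).
Proof.
case: X Y f g => [x|] [y|] /= f g; first exact: path_spanP.
all: by move=> -> ->; rewrite scaler0 addr0.
Qed.

Lemma spanned0 (X Y : Lambda R k) : spanned (0 : hom X Y).
Proof. by case: X Y => [x|] [y|] //=; apply: path_span0. Qed.

Lemma spanned_term (X Y : option R) (t : term k (@gen R) X Y) :
  spanned (term_hom t).
Proof.
elim: X Y / t => //=.
- by move=> X Y [x y h|x y h]; [apply: path_span_alpha|apply: path_span_alphas].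
- move=> [x|] /=; last exact: idm_None.
  rewrite -[term_hom _]/(idm (pt k x)) -lpath0; apply: path_span_lpath.
  by rewrite subrr normr0.
- move=> X Y Z t IHt s IHs.
  have -> : term_hom (tcmp t s) = cmp (term_hom t) (term_hom s).
    by rewrite [RHS]cmp_ann cmp_pres.
  case: Y t s IHt IHs => [y|] t s; last first.
    by rewrite (hom_to_zero (term_hom s) idm_None) cmpm0 => _ _; apply: spanned0.
  case: X s => [x|] s; last first.
    rewrite (hom_from_zero (term_hom s) idm_None) cmpm0 => _ _.
    exact: spanned0.
  case: Z t => [z|] t; last first.
    by rewrite (hom_to_zero (term_hom t) idm_None) cmp0m => _ _; apply: spanned0.
  exact: path_span_cmp.
- by move=> X Y; apply: (spanned0 X Y).
- move=> X Y s IHs t IHt.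
  have -> : term_hom (tadd s t) = 1 *: term_hom s + term_hom t.
    rewrite ann_clP pres_clP; congr ann_cl; apply/pres_clE.
    apply: cong_add; last exact: cong_refl.
    exact/cong_sym/cong_scale1.
  exact: spannedP.
- move=> X Y a s IHs.
  have -> : term_hom (tscale a s) = a *: term_hom s + 0.
    rewrite [X in _ + X](_ : 0 = term_hom (tzero X Y)) // ann_clP pres_clP.
    congr ann_cl; apply/pres_clE; apply: cong_sym.
    by apply: cong_trans; [apply: cong_addC|apply: cong_add0].
  by apply: spannedP => //; apply: spanned0.
Qed.

Lemma hom_path_span x y (f : hom (pt k x) (pt k y)) : path_span f.
Proof.
elim/ann_quotW: f => f; elim/pres_quotW: f => t.
exact: (spanned_term t).
Qed.

Lemma coef0 x y l : coef (0 : hom (pt k x) (pt k y)) l = 0.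
Proof.
have := coefP (-1) (0 : hom (pt k x) (pt k y)) 0 l.
by rewrite scaler0 addr0 mulN1r addNr.
Qed.

Lemma coef_sum x y (I : eqType) (r : seq I) (c : I -> k)
    (f : I -> hom (pt k x) (pt k y)) l :
  coef (\sum_(i <- r) c i *: f i) l = \sum_(i <- r) c i * coef (f i) l.
Proof.
by elim: r => [|i r IHr]; rewrite ?big_nil ?coef0 // !big_cons coefP IHr.
Qed.

Lemma coef_supp x y (f : hom (pt k x) (pt k y)) l : coef f l != 0 ->
  `|x - y| <= l /\ l < len_bound x y.
Proof.
move=> fl; split.
  by rewrite leNgt; apply: contra fl => lt_l; rewrite coef_lt_dist.
by rewrite ltNge; apply: contra fl => le_l; rewrite coef_ge_bound.
Qed.

(** The expansion of [f] holds over every duplicate-free list containing enough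
    lengths, a form of the claim that passes to linear combinations; the
    coefficients then single out the smallest such list. *)
Lemma coef_expand x y (f : hom (pt k x) (pt k y)) : exists s : seq R,
  [/\ uniq s, forall l, (l \in s) = (coef f l != 0) &
      f = \sum_(l <- s) coef f l *: lpath x y l].
Proof.
have [s s_f] : exists s : seq R, forall s' : seq R,
    uniq s' -> {subset s <= s'} -> f = \sum_(l <- s') coef f l *: lpath x y l.
  elim: {f}(hom_path_span f) => [l le_l||a f g _ [s s_f] _ [t t_g]].
  - have [le_bd|lt_bd] := leP (len_bound x y) l.
      exists [::] => s' _ _; rewrite (lpath_ge_bound le_l) // big1 // => m _.
      by rewrite coef0 scale0r.
    exists [:: l] => s' us' ls'.
    have {}ls' : l \in s' by apply: ls'; rewrite mem_head.
    rewrite (bigD1_seq l) //= coef_lpath // eqxx scale1r big1 ?addr0 // => m ml.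
    have [le_bd|lt_m] := leP (len_bound x y) m.
      by rewrite coef_ge_bound ?scale0r.
    by rewrite coef_lpath // (negbTE ml) scale0r.
  - by exists [::] => s' _ _; rewrite big1 // => l _; rewrite coef0 scale0r.
  - exists (s ++ t) => s' us' sub_s'.
    rewrite {1}(s_f s') // => [|l ls]; last by apply: sub_s'; rewrite mem_cat ls.
    rewrite {1}(t_g s') // => [|l lt]; last first.
      by apply: sub_s'; rewrite mem_cat lt orbT.
    rewrite scaler_sumr -big_split /=; apply: eq_bigr => l _.
    by rewrite coefP scalerDl scalerA.
have {}s_f : f = \sum_(l <- undup s) coef f l *: lpath x y l.
  by apply: s_f => [|l]; rewrite ?undup_uniq ?mem_undup.
exists [seq l <- undup s | coef f l != 0]; split.
- by rewrite filter_uniq ?undup_uniq.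
- move=> l; rewrite mem_filter; case: eqP => //= /eqP fl.
  apply: contraNT fl => lNs; rewrite {1}s_f coef_sum big1_seq // => m /andP[_ ms].
  have [->|fm] := eqVneq (coef f m) 0; first by rewrite mul0r.
  have [le_bd|lt_l] := leP (len_bound x y) l.
    by rewrite (coef_ge_bound _ le_bd) mulr0.
  rewrite coef_lpath ?(coef_supp fm).1 //.
  by case: eqP lNs => [->|_ _]; rewrite ?ms /= ?mulr0.
- rewrite big_filter {1}s_f [LHS](bigID (fun l => coef f l != 0)) /=.
  by rewrite [X in _ + X]big1 ?addr0 // => l /negbNE/eqP ->; rewrite scale0r.
Qed.

Lemma coef_eq0 x y (f : hom (pt k x) (pt k y)) :
  (forall l, coef f l = 0) -> f = 0.
Proof.
have [s [_ _ fE]] := coef_expand f => f0; rewrite fE big1 // => l _.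
by rewrite f0 scale0r.
Qed.

Lemma lpath_neq0 x y l : `|x - y| <= l -> l < len_bound x y -> lpath x y l <> 0.
Proof.
move=> le_l lt_l p0; have := coef_lpath le_l lt_l.
by rewrite p0 coef0 eqxx => /eqP; rewrite eq_sym oner_eq0.
Qed.

Lemma path_like_lpath x y (f : hom (pt k x) (pt k y)) l :
  path_like f l <-> [/\ f = lpath x y l, `|x - y| <= l & l < len_bound x y].
Proof.
split=> [[/composite_lpath[le_l ->] f0]|[-> le_l lt_l]].
  split=> //; rewrite ltNge; apply/negP => ge_l; exact/f0/lpath_ge_bound.
by split; [apply: lpath_composite|apply: lpath_neq0].
Qed.

End Paths.

(** * Submodules of representables are monomial *)
Lemma seq_min (R : realType) (s : seq R) : s != [::] ->
  exists2 m, m \in s & forall l, l \in s -> m <= l.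
Proof.
elim: s => // a s IHs _; have [->|/IHs[m ms m_min]] := eqVneq s [::].
  by exists a => [|l]; rewrite inE // => /eqP ->.
have [le_am|lt_ma] := leP a m.
  exists a => [|l]; rewrite inE ?eqxx // => /predU1P[->//|/m_min].
  exact: le_trans.
exists m => [|l]; rewrite inE ?ms ?orbT // => /predU1P[->|/m_min//].
exact: ltW.
Qed.

Lemma sum_neq0 (V : nmodType) (I : eqType) (r : seq I) (c : I -> V) :
  \sum_(i <- r) c i != 0 -> exists2 i, i \in r & c i != 0.
Proof.
move=> c0; apply: contrapT => Nc; move/eqP: c0; apply.
rewrite big1_seq // => i /andP[_ ir]; apply: contrapT => /eqP ci0.
by apply: Nc; exists i.
Qed.

Section Submodules.
Variables (R : realType) (k : closedFieldType).
Implicit Types (l m s x y z : R).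

Lemma sub_ext x (M N : submodule (projective k x)) :
  (forall (Y : Lambda R k) (f : hom (pt k x) Y), sub_ob M Y f <-> sub_ob N Y f) ->
  M = N.
Proof.
case: M N => [M M0 MP Mm] [N N0 NP Nm] /= MN.
have {}MN : M = N.
  apply: functional_extensionality_dep => Y; apply/funext => f.
  by apply/propext/MN.
by subst N; congr Submodule; apply: Prop_irrelevance.
Qed.

Section Sub.
Variables (x : R) (M : submodule (projective k x)).

Lemma sub_cmp (Y Z : Lambda R k) (g : hom Y Z) (f : hom (pt k x) Y) :
  sub_ob M Y f -> sub_ob M Z (cmp g f).
Proof. exact: (sub_map (s := M) g). Qed.

Lemma sub_sum (Y : Lambda R k) (I : eqType) (r : seq I) (c : I -> k)
    (f : I -> hom (pt k x) Y) :
  (forall i, i \in r -> sub_ob M Y (f i)) ->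
  sub_ob M Y (\sum_(i <- r) c i *: f i).
Proof.
elim: r => [|i r IHr] Mf; first by rewrite big_nil; apply: sub0.
rewrite big_cons; apply: subP; first by apply: Mf; rewrite mem_head.
by apply: IHr => j jr; apply: Mf; rewrite inE jr orbT.
Qed.

Lemma sub_lpath_le y l m : `|x - y| <= l -> l <= m ->
  sub_ob M (pt k y) (lpath k x y l) -> sub_ob M (pt k y) (lpath k x y m).
Proof.
move=> le_l lm Ml; rewrite -[m](subrKC l) -(@lpath_lpath R k x y y) //.
  exact: sub_cmp.
by rewrite subrr normr0 subr_ge0.
Qed.

(** Let [e] separate [l] from the other lengths in [f].  Modulo paths longer by
    at least [e], the path of length [m >= l] is a multiple of the composite of
    [f] with a loop of length [m - l]; as long paths vanish, membership
    propagates downwards to [l] in steps of [e]. *)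
Lemma sub_min_lpath y (f : hom (pt k x) (pt k y)) l :
  sub_ob M (pt k y) f -> coef f l != 0 ->
  (forall m, coef f m != 0 -> l <= m) -> sub_ob M (pt k y) (lpath k x y l).
Proof.
move=> Mf fl l_min; have [s [us s_f fE]] := coef_expand f.
have ls : l \in s by rewrite s_f.
have [e e0 s_e] : exists2 e : R, 0 < e & forall m, m \in rem l s -> l + e <= m.
  have [->|/seq_min[m ms m_min]] := eqVneq (rem l s) [::]; first by exists 1.
  move: (ms); rewrite mem_rem_uniq // inE => /andP[ml m_s].
  exists (m - l); last by move=> n /m_min; rewrite subrKC.
  by rewrite subr_gt0 lt_neqAle eq_sym ml l_min // -s_f.
have [le_l lt_l] := coef_supp fl.
have step (n : nat) m : l <= m -> len_bound x y <= m + e * n%:R ->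
    sub_ob M (pt k y) (lpath k x y m).
  elim: n m => [|n IHn] m lm le_m.
    rewrite lpath_ge_bound ?(le_trans le_l) //; first exact: sub0.
    by rewrite mulr0 addr0 in le_m.
  have le_ml : `|y - y| <= m - l by rewrite subrr normr0 subr_ge0.
  pose h := \sum_(n <- rem l s) coef f n *: lpath k x y (n + (m - l)).
  have fmE : cmp (lpath k y y (m - l)) f = coef f l *: lpath k x y m + h.
    rewrite {1}fE cmp_sumr (perm_big _ (perm_to_rem ls)) big_cons.
    rewrite lpath_lpath // subrKC; congr (_ + _); apply: eq_big_seq => j js.
    rewrite lpath_lpath //; have /mem_rem := js.
    by rewrite s_f => /coef_supp[].
  have -> : lpath k x y m =
      (coef f l)^-1 *: (-1 *: h + cmp (lpath k y y (m - l)) f) + 0.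
    by rewrite fmE addrCA scaleN1r addNr !addr0 scalerA mulVf // scale1r.
  apply: subP; last exact: sub0.
  apply: subP; last exact: sub_cmp.
  apply: sub_sum => j /s_e le_j; apply: IHn; first lra.
  by move: le_m; rewrite -natr1 mulrDr mulr1; lra.
have [n le_n] : exists n, len_bound x y <= l + e * n%:R.
  exists (Num.truncn ((len_bound x y - l) / e)).+1.
  have := ltW (truncnS_gt ((len_bound x y - l) / e)).
  by rewrite ler_pdivrMr // mulrC lerBlDl.
exact: step le_n.
Qed.

(** The shortest path occurring in [f] lies in M, and composing it with loops
    gives the longer ones. *)
Lemma sub_coef y (f : hom (pt k x) (pt k y)) l :
  sub_ob M (pt k y) f -> coef f l != 0 -> sub_ob M (pt k y) (lpath k x y l).
Proof.
move=> Mf fl; have [s [us s_f fE]] := coef_expand f.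
have [|m ms m_min] := @seq_min _ s.
  by case: s s_f {us fE} => // /(_ l); rewrite fl.
have fm : coef f m != 0 by rewrite -s_f.
have Mm : sub_ob M (pt k y) (lpath k x y m).
  by apply: (sub_min_lpath Mf fm) => j; rewrite -s_f; apply: m_min.
by apply: sub_lpath_le Mm; [case: (coef_supp fm)|rewrite m_min // s_f].
Qed.

Lemma sub_of_coef y (f : hom (pt k x) (pt k y)) :
  (forall l, coef f l != 0 -> sub_ob M (pt k y) (lpath k x y l)) ->
  sub_ob M (pt k y) f.
Proof.
have [s [us s_f fE]] := coef_expand f => Mf.
by rewrite fE; apply: sub_sum => l; rewrite s_f; apply: Mf.
Qed.

End Sub.

Lemma coef_cmp x y z (g : hom (pt k y) (pt k z)) (f : hom (pt k x) (pt k y)) l :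
  coef (cmp g f) l != 0 ->
  exists m n, [/\ coef f m != 0, coef g n != 0 & l = m + n].
Proof.
have [s [_ s_f fE]] := coef_expand f; have [t [_ t_g gE]] := coef_expand g.
rewrite {1}fE cmp_sumr coef_sum => /sum_neq0[m ms].
rewrite {1}gE cmp_suml coef_sum mulf_eq0 negb_or -s_f ms => /sum_neq0[n nt].
rewrite mulf_eq0 negb_or -t_g nt andTb => /[dup] /coef_supp[_ lt_l].
have [le_m _] : `|x - y| <= m /\ m < len_bound x y.
  by apply: (coef_supp (f := f)); rewrite -s_f.
have [le_n _] : `|y - z| <= n /\ n < len_bound y z.
  by apply: (coef_supp (f := g)); rewrite -t_g.
rewrite lpath_lpath // coef_lpath //; last exact: dist_add le_m le_n.
case: (eqVneq l (m + n)) => [->|_]; last by rewrite eqxx.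
by exists m, n; rewrite -s_f -t_g.
Qed.

(** * The submodule above a function *)
Section SubAbove.
Variables (x : R) (d : I01 R -> R).

(** For a 1-Lipschitz [d] the condition says [d y <= l].  In this form, which
    replaces [d] by its least 1-Lipschitz majorant, it defines a submodule for
    every [d]. *)
Definition above_ob (Y : Lambda R k) : set (projective k x Y) :=
  match Y return set (projective k x Y) with
  | Some y => fun f => forall l, @coef R k x y f l != 0 ->
                forall w, d w <= l + `|sval w - y|
  | None => setT
  end.

Lemma above0 Y : above_ob (0 : projective k x Y).
Proof. by case: Y => [y|] //= l; rewrite coef0 eqxx. Qed.

Lemma aboveP Y a (f g : projective k x Y) :
  above_ob f -> above_ob g -> above_ob (a *: f + g).
Proof.
case: Y f g => [y|] //= f g df dg l; rewrite [coef _ _]coefP.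
have [fl|fl] := eqVneq (coef f l) 0; last by move=> _; exact: df.
by rewrite fl mulr0 add0r; apply: dg.
Qed.

Lemma above_map (Y Z : Lambda R k) (g : hom Y Z) (f : projective k x Y) :
  above_ob f -> above_ob (mod_map (projective k x) g f).
Proof.
rewrite -[mod_map _ _ _]/(cmp g (f : hom (pt k x) Y)).
case: Z g => [z|] //; case: Y f => [y|] f g df; last first.
  by rewrite [f](hom_to_zero f (idm_None R k)) cmpm0; apply: above0.
move=> l /coef_cmp[m [n [fm gn ->]]] w.
have [le_n _] := coef_supp gn; have := ler_distD z (sval w) y.
by have := df _ fm w; rewrite [`|z - y|]distrC; lra.
Qed.

Definition sub_above : submodule (projective k x) :=
  Submodule above0 aboveP above_map.

End SubAbove.
End Submodules.

(** * Boundaries of decorous submodules *)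
Section Boundary.
Variables (R : realType) (k : closedFieldType).
Implicit Types (l m s x : R) (y z : I01 R).

Lemma dist_lt_bound (x y : R) :
  0 < x < 1 -> 0 < y < 1 -> `|x - y| < len_bound x y.
Proof.
move=> /andP[x0 x1] /andP[y0 y1]; rewrite /len_bound lt_min.
by case: (ger0P (x - y)) => h; apply/andP; split; lra.
Qed.

Lemma len_bound_edge x y : 0 < x < 1 -> sval y = 0 \/ sval y = 1 ->
  len_bound x (sval y) = `|x - sval y|.
Proof.
move=> /andP[x0 x1] [->|->]; rewrite /len_bound.
  by rewrite !subr0 addr0 gtr0_norm // min_l //; lra.
by rewrite ltr0_norm ?min_r; lra.
Qed.

Lemma I01_cases y : [\/ 0 < sval y < 1, sval y = 0 | sval y = 1].
Proof.
case: y => y /= /andP[]; rewrite !le_eqVlt => /predU1P[<-|y0].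
  by move=> _; constructor 2.
by case/predU1P=> [->|y1]; [constructor 3|constructor 1; rewrite y0].
Qed.

Section Decorous.
Variables (x : R) (x01 : 0 < x < 1) (M : submodule (projective k x)).

Lemma bdry_up_edge y : sval y = 0 \/ sval y = 1 -> bdry_up M y = `|x - sval y|.
Proof.
case/andP: x01 => x0 x1 [] yE; rewrite /bdry_up yE eqxx.
  by rewrite subr0 gtr0_norm.
by rewrite oner_eq0 ltr0_norm ?opprB // subr_lt0.
Qed.

Lemma bdry_up_nonzero y : 0 < sval y < 1 -> nonzero_at M (sval y) ->
  bdry_up M y = inf [set l | exists f : hom (pt k x) (pt k (sval y)),
                      sub_ob M (pt k (sval y)) f /\ path_like f l].
Proof.
move=> /andP[y0 y1] Mn; rewrite /bdry_up gt_eqF // lt_eqF //.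
by case: asboolP.
Qed.

Lemma bdry_up_zero y : 0 < sval y < 1 -> ~ nonzero_at M (sval y) ->
  bdry_up M y = len_bound x (sval y).
Proof.
move=> y01 Mn; have /andP[y0 y1] := y01.
rewrite /bdry_up gt_eqF // lt_eqF //; case: asboolP => // _.
have -> : [set l | exists f : hom (pt k x) (pt k (sval y)), path_like f l] =
          [set l | `|x - sval y| <= l < len_bound x (sval y)].
  apply/seteqP; split=> l /=; first by move=> [f /path_like_lpath[_ -> ->]].
  move=> /andP[le_l lt_l]; exists (lpath k x (sval y) l).
  exact/path_like_lpath.
have lt_bd := dist_lt_bound x01 y01.
have ub : ubound [set l | `|x - sval y| <= l < len_bound x (sval y)]
    (len_bound x (sval y)).
  by move=> l /= /andP[_ /ltW].
apply/eqP; rewrite eq_le; apply/andP; split.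
  by apply: ge_sup => //; exists `|x - sval y|; rewrite /= lexx.
rewrite leNgt; apply/negP; set b := sup _ => lt_b.
have le_b l : `|x - sval y| <= l < len_bound x (sval y) -> l <= b.
  by move=> l_in; apply: ub_le_sup => //; exists (len_bound x (sval y)).
have le_xb : `|x - sval y| <= b by apply: le_b; rewrite lexx.
suff : (b + len_bound x (sval y)) / 2 <= b by lra.
by apply: le_b; apply/andP; split; lra.
Qed.

Lemma bdry_up_le y l : 0 < sval y < 1 -> nonzero_at M (sval y) ->
  `|x - sval y| <= l -> l < len_bound x (sval y) ->
  sub_ob M (pt k (sval y)) (lpath k x (sval y) l) -> bdry_up M y <= l.
Proof.
move=> y01 Mn le_l lt_l Ml; rewrite bdry_up_nonzero //; apply: ge_inf.
  exists `|x - sval y| => m /= [f [_ /path_like_lpath[]]] //.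
by exists (lpath k x (sval y) l); split=> //; apply/path_like_lpath.
Qed.

Hypothesis Mdec : decorous M.

Lemma decorous_bdry y : 0 < sval y < 1 -> nonzero_at M (sval y) ->
  [/\ `|x - sval y| <= bdry_up M y, bdry_up M y < len_bound x (sval y) &
      sub_ob M (pt k (sval y)) (lpath k x (sval y) (bdry_up M y))].
Proof.
move=> y01 Mn; have [f [Mf /path_like_lpath[fE le_b lt_b]]] := Mdec y01 Mn.
by split=> //; rewrite -fE.
Qed.

Lemma bdry_up_range y : `|x - sval y| <= bdry_up M y <= len_bound x (sval y).
Proof.
have edge : sval y = 0 \/ sval y = 1 ->
    `|x - sval y| <= bdry_up M y <= len_bound x (sval y).
  by move=> ye; rewrite (bdry_up_edge ye) (len_bound_edge x01 ye) lexx.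
have [y01|y0|y1] := I01_cases y; [|by apply: edge; left|by apply: edge; right].
have [Mn|Mn] := pselect (nonzero_at M (sval y)).
  by have [-> /ltW ->] := decorous_bdry y01 Mn.
by rewrite (bdry_up_zero y01 Mn) lexx ltW ?dist_lt_bound.
Qed.

(** When [M(y) = 0] the boundary is [len_bound x y], which exceeds the length
    of every path that can occur in [f]. *)
Lemma mem_decorous y (f : hom (pt k x) (pt k (sval y))) : 0 < sval y < 1 ->
  sub_ob M (pt k (sval y)) f <-> forall l, coef f l != 0 -> bdry_up M y <= l.
Proof.
move=> y01; have [Mn|Mn] := pselect (nonzero_at M (sval y)).
  have [le_b lt_b Mb] := decorous_bdry y01 Mn.
  split=> [Mf l fl|f_ge].
    have [le_l lt_l] := coef_supp fl.
    by apply: bdry_up_le => //; apply: sub_coef fl.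
  by apply: sub_of_coef => l /f_ge le_l; apply: sub_lpath_le Mb.
rewrite (bdry_up_zero y01 Mn); split=> [Mf l fl|f_ge].
  have [f0|/eqP f0] := eqVneq f 0; first by rewrite f0 coef0 eqxx in fl.
  by case: Mn; exists f.
rewrite (_ : f = 0); first exact: sub0.
apply: coef_eq0 => l; have [//|fl] := eqVneq (coef f l) 0.
by have [_] := coef_supp fl; rewrite ltNge f_ge.
Qed.

(** Prolonging the shortest path of [M(y)] by the direct path from [y] to [z]
    gives an element of [M(z)]; if it vanishes then the claim follows from
    [bdry_up M z <= len_bound x z]. *)
Lemma bdry_up_lip y z : bdry_up M z <= bdry_up M y + `|sval y - sval z|.
Proof.
have [/andP[ly uy] /andP[_ uz]] := (bdry_up_range y, bdry_up_range z).
have [le_bd|lt_bd] := leP (len_bound x (sval y)) (bdry_up M y).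
  apply: le_trans uz (le_trans (len_bound_dist _ (sval y) _) _).
  by rewrite lerD2r.
have edge : sval z = 0 \/ sval z = 1 ->
    bdry_up M z <= bdry_up M y + `|sval y - sval z|.
  move/bdry_up_edge=> ->; exact: dist_add ly _.
have [z01|z0|z1] := I01_cases z; [|by apply: edge; left|by apply: edge; right].
have [le_z|lt_z] :=
  leP (len_bound x (sval z)) (bdry_up M y + `|sval y - sval z|).
  exact: le_trans le_z.
have y01 : 0 < sval y < 1.
  have edge' : sval y = 0 \/ sval y = 1 -> len_bound x (sval y) <= bdry_up M y.
    by move=> ye; rewrite (len_bound_edge x01 ye).
  have [//|y0|y1] := I01_cases y.
    by have := edge' (or_introl y0); rewrite leNgt lt_bd.
  by have := edge' (or_intror y1); rewrite leNgt lt_bd.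
have Mb : sub_ob M (pt k (sval y)) (lpath k x (sval y) (bdry_up M y)).
  apply/mem_decorous => // l fl; have [_ lt_l] := coef_supp fl.
  move: fl; rewrite coef_lpath //.
  by case: (eqVneq l (bdry_up M y)) => [->|_]; rewrite ?eqxx.
have := sub_cmp (lpath k (sval y) (sval z) `|sval y - sval z|) Mb.
rewrite lpath_lpath // => /(mem_decorous _ z01); apply.
by rewrite coef_lpath ?eqxx ?oner_eq0 //; apply: dist_add ly _.
Qed.

Lemma bdry_bdry_up : bdry (bdry_up M).
Proof.
split.
  move=> y z; have := bdry_up_lip y z; have := bdry_up_lip z y.
  by rewrite distrC ler_norml => h1 h2; apply/andP; split; lra.
have /andP[x0 x1] := x01.
rewrite (bdry_up_edge (or_introl (erefl : sval (i0 R) = 0))).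
rewrite (bdry_up_edge (or_intror (erefl : sval (i1 R) = 1))) /=.
rewrite subr0 (gtr0_norm x0) ltr0_norm ?subr_lt0 // opprB.
by split=> h; lra.
Qed.

Lemma sub_above_bdry_up : sub_above k x (bdry_up M) = M.
Proof.
apply: sub_ext => -[y|] f /=; last first.
  by rewrite [f](hom_to_zero f (idm_None R k)); split=> // _; apply: sub0.
have [y01|yout] := boolP (0 < y < 1); last first.
  rewrite [f](hom_to_zero f (idm_outside k yout)).
  by split=> [_|_ l]; [apply: sub0|rewrite coef0 eqxx].
have yI : 0 <= y <= 1 by have /andP[/ltW-> /ltW->] := y01.
have memM := @mem_decorous (exist _ y yI) f y01.
rewrite memM; split=> f_ge l fl.
  by have := f_ge l fl (exist _ y yI); rewrite /= subrr normr0 addr0.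
move=> w; apply: le_trans (bdry_up_lip (exist _ y yI) w) _ => /=.
by rewrite distrC lerD2r f_ge.
Qed.

End Decorous.

(** * The boundary of the submodule above a Lipschitz function *)
Section SubAboveBoundary.
Variables (x : R) (e : I01 R -> R).
Hypothesis x01 : 0 < x < 1.
Hypothesis e_lip : forall y z, `|e y - e z| <= `|sval y - sval z|.
Hypotheses (e0 : e (i0 R) = x) (e1 : e (i1 R) = 1 - x).

Lemma mem_sub_above y (f : hom (pt k x) (pt k (sval y))) :
  sub_ob (sub_above k x e) (pt k (sval y)) f <->
  forall l, coef f l != 0 -> e y <= l.
Proof.
split=> f_ge l fl.
  by have := f_ge l fl y; rewrite subrr normr0 addr0.
move=> w; have := e_lip w y; rewrite ler_norml => /andP[_].
by have := f_ge l fl; lra.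
Qed.

Lemma lip_range y : `|x - sval y| <= e y <= len_bound x (sval y).
Proof.
have := e_lip y (i0 R); have := e_lip y (i1 R); rewrite e0 e1 /=.
have /andP[y0 y1] := svalP y; rewrite subr0 (ger0_norm y0).
rewrite [`|sval y - 1|]ler0_norm ?subr_le0 // !ler_norml.
move=> /andP[a1 a2] /andP[a3 a4].
rewrite /len_bound le_min; apply/andP; split; first by apply/andP; split; lra.
by apply/andP; split; lra.
Qed.

Lemma lpath_sub_above y l : e y <= l -> l < len_bound x (sval y) ->
  sub_ob (sub_above k x e) (pt k (sval y)) (lpath k x (sval y) l).
Proof.
have /andP[le_e _] := lip_range y => le_l lt_l; apply/mem_sub_above => m fm.
have [_ lt_m] := coef_supp fm; move: fm; rewrite coef_lpath ?(le_trans le_e) //.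
by case: (eqVneq m l) => [->|_]; rewrite ?eqxx.
Qed.

Lemma bdry_up_sub_above y : bdry_up (sub_above k x e) y = e y.
Proof.
have [y01|y0|y1] := I01_cases y; last 2 first.
- rewrite bdry_up_edge //; last by left.
  apply/eqP; rewrite eq_le; have := lip_range y.
  by rewrite (len_bound_edge x01 (or_introl y0)) andbC.
- rewrite bdry_up_edge //; last by right.
  apply/eqP; rewrite eq_le; have := lip_range y.
  by rewrite (len_bound_edge x01 (or_intror y1)) andbC.
have /andP[le_e ge_e] := lip_range y.
have [lt_e|le_bd] := ltP (e y) (len_bound x (sval y)).
  have Me := lpath_sub_above (lexx _) lt_e.
  have Mn : nonzero_at (sub_above k x e) (sval y).
    by exists (lpath k x (sval y) (e y)); split=> //; apply: lpath_neq0.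
  apply/eqP; rewrite eq_le bdry_up_le // bdry_up_nonzero //.
  apply: lb_le_inf.
    exists (e y); exists (lpath k x (sval y) (e y)); split=> //.
    by apply/path_like_lpath.
  move=> l [f [/mem_sub_above Mf /path_like_lpath[fE le_l lt_l]]]; apply: Mf.
  by rewrite fE coef_lpath // eqxx oner_eq0.
rewrite bdry_up_zero //.
  by apply/eqP; rewrite eq_le le_bd ge_e.
move=> [f [/mem_sub_above Mf]]; apply; apply: coef_eq0 => l.
have [//|fl] := eqVneq (coef f l) 0; have [_] := coef_supp fl.
by rewrite ltNge (le_trans le_bd) // Mf.
Qed.

Lemma decorous_sub_above : decorous (sub_above k x e).
Proof.
move=> y y01 [f [/mem_sub_above Mf f0]]; rewrite bdry_up_sub_above.
have [l fl] : exists l, coef f l != 0.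
  apply: contrapT => fN; apply/f0/coef_eq0 => l.
  by have [//|fl] := eqVneq (coef f l) 0; case: fN; exists l.
have [_ lt_l] := coef_supp fl.
have lt_e := le_lt_trans (Mf l fl) lt_l.
exists (lpath k x (sval y) (e y)); split; first exact: lpath_sub_above.
by apply/path_like_lpath; split=> //; case/andP: (lip_range y).
Qed.

End SubAboveBoundary.

(** * The bijection *)

(** The only [x] for which a translate of [d] takes the values [x] at 0 and
    [1 - x] at 1. *)
Definition root_of (d : I01 R -> R) : R := (1 + d (i0 R) - d (i1 R)) / 2.

Definition normalized (d : I01 R -> R) : I01 R -> R :=
  fun y => d y + (root_of d - d (i0 R)).

(** Keeping [x] and [e] as arguments lets equations between them be rewritten
    inside the dependent pair. *)
Definition tagged_sub_above x (e : I01 R -> R) :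
    {x : R & submodule (projective k x)} :=
  existT _ x (sub_above k x e).

Definition sub_of_bdry d := tagged_sub_above (root_of d) (normalized d).

Lemma root_of_sim d d' : bdry_sim d d' -> root_of d = root_of d'.
Proof. by move=> [a dE]; rewrite /root_of !dE; field. Qed.

Lemma normalized_sim d d' : bdry_sim d d' -> normalized d = normalized d'.
Proof.
move=> dd'; apply/funext => y; rewrite /normalized (root_of_sim dd').
by case: dd' => a dE; rewrite !dE; ring.
Qed.

Lemma sub_of_bdry_sim d d' : bdry_sim d d' -> sub_of_bdry d = sub_of_bdry d'.
Proof.
by move=> dd'; rewrite /sub_of_bdry (root_of_sim dd') (normalized_sim dd').
Qed.

Lemma normalized_lip d : bdry d ->
  forall y z, `|normalized d y - normalized d z| <= `|sval y - sval z|.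
Proof.
by move=> [d_lip _] y z; rewrite /normalized opprD addrACA subrr addr0.
Qed.

Lemma normalized0 d : normalized d (i0 R) = root_of d.
Proof. by rewrite /normalized subrKC. Qed.

Lemma normalized1 d : normalized d (i1 R) = 1 - root_of d.
Proof. by rewrite /normalized /root_of; field. Qed.

Lemma root_of01 d : bdry d -> 0 < root_of d < 1.
Proof.
move=> [d_lip [/eqP ne1 /eqP ne2]]; have := d_lip (i1 R) (i0 R).
rewrite /= subr0 normr1 ler_norml => /andP[ge_d le_d].
have lt1 : d (i1 R) < d (i0 R) + 1 by rewrite lt_neqAle ne1; lra.
have lt2 : d (i0 R) - 1 < d (i1 R) by rewrite lt_neqAle eq_sym ne2; lra.
by rewrite /root_of; apply/andP; split; lra.
Qed.

Lemma bdry_up_sub_of_bdry d : bdry d ->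
  bdry_up (tagged (sub_of_bdry d)) = normalized d.
Proof.
move=> bd; apply/funext => y.
exact: bdry_up_sub_above (root_of01 bd) (normalized_lip bd) (normalized0 d)
  (normalized1 d) y.
Qed.

Lemma sub_of_bdry_decorous d :
  bdry d -> decorous_submodules R k (sub_of_bdry d).
Proof.
move=> bd; split; first exact: root_of01.
exact: decorous_sub_above (root_of01 bd) (normalized_lip bd) (normalized0 d)
  (normalized1 d).
Qed.

Lemma sub_of_bdry_up (M : {x : R & submodule (projective k x)}) :
  decorous_submodules R k M -> sub_of_bdry (bdry_up (tagged M)) = M.
Proof.
case: M => x M [/= x01 Mdec].
have b0 : bdry_up M (i0 R) = x by rewrite /bdry_up /= eqxx.
have b1 : bdry_up M (i1 R) = 1 - x by rewrite /bdry_up /= oner_eq0 eqxx.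
have rE : root_of (bdry_up M) = x by rewrite /root_of b0 b1; field.
have dE : normalized (bdry_up M) = bdry_up M.
  by apply/funext => y; rewrite /normalized rE b0 subrr addr0.
by rewrite /sub_of_bdry rE dE /tagged_sub_above sub_above_bdry_up.
Qed.

Lemma bdry_sim_refl (d : I01 R -> R) : bdry_sim d d.
Proof. by exists 0 => y; rewrite addr0. Qed.

Lemma bdry_sim_sym (d d' : I01 R -> R) : bdry_sim d d' -> bdry_sim d' d.
Proof. by move=> [a dE]; exists (- a) => y; rewrite dE addrK. Qed.

Lemma bdry_sim_trans (d d' d'' : I01 R -> R) :
  bdry_sim d d' -> bdry_sim d' d'' -> bdry_sim d d''.
Proof.
by move=> [a dE] [b dE']; exists (b + a) => y; rewrite dE dE' addrA.
Qed.

Lemma bdry_sim_normalized d : bdry_sim d (normalized d).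
Proof. by exists (d (i0 R) - root_of d) => y; rewrite /normalized; ring. Qed.

Lemma bdry_class_sim (d d' : I01 R -> R) :
  bdry_sim d d' -> bdry_class d = bdry_class d'.
Proof.
move=> dd'; apply/seteqP; split=> e [be de]; split=> //.
  exact: bdry_sim_trans (bdry_sim_sym dd') de.
exact: bdry_sim_trans dd' de.
Qed.

Definition sub_of_class (C : set (I01 R -> R)) :=
  sub_of_bdry (xget (fun=> 0) C).

Lemma sub_of_classE d : bdry d -> sub_of_class (bdry_class d) = sub_of_bdry d.
Proof.
move=> bd; have [] : bdry_class d (xget (fun=> 0) (bdry_class d)).
  by apply: xgetPex; exists d; split=> //; apply: bdry_sim_refl.
by move=> _ /sub_of_bdry_sim.
Qed.

End Boundary.

Theorem theorem1 (R : realType) (k : closedFieldType) :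
  exists F : set (I01 R -> R) -> {x : R & submodule (projective k x)},
    set_bij (bdry_quotient R) (decorous_submodules R k) F /\
    (forall M : {x : R & submodule (projective k x)}, decorous_submodules R k M ->
      bdry (bdry_up (tagged M)) /\ F (bdry_class (bdry_up (tagged M))) = M).
Proof.
have retract (M : {x : R & submodule (projective k x)}) :
    decorous_submodules R k M -> bdry (bdry_up (tagged M)) /\
    sub_of_class k (bdry_class (bdry_up (tagged M))) = M.
  move=> decM; have bM : bdry (bdry_up (tagged M)).
    by case: decM => x01 Mdec; apply: bdry_bdry_up.
  by split=> //; rewrite sub_of_classE // sub_of_bdry_up.
exists (sub_of_class k); split=> //; split.
- by move=> _ [d bd <-]; rewrite sub_of_classE //; apply: sub_of_bdry_decorous.
- move=> C C' /set_mem[d bd <-] /set_mem[d' bd' <-].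
  rewrite !sub_of_classE // => FE; apply: bdry_class_sim.
  have rE : normalized d = normalized d'.
    by rewrite -(bdry_up_sub_of_bdry k bd) -(bdry_up_sub_of_bdry k bd') FE.
  apply: bdry_sim_trans (bdry_sim_normalized d) _.
  by rewrite rE; apply: bdry_sim_sym (bdry_sim_normalized d').
- move=> M /retract[bM FM]; exists (bdry_class (bdry_up (tagged M))) => //.
  by exists (bdry_up (tagged M)).
Qed.
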